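(* Let $K\subset\mathbb{R}^2$ be a parallelogram. Then the infimum $\alpha_1(K)=\inf\{R(K,\Phi_U(K)) : U\subset\mathbb{R}^2\text{ affine subspace},\ \dim U=1\}$ is attained at some $U$, and any $U$ at which it is attained is necessarily parallel to (i) the bisector of an angle formed by consecutive edges of $K$, (ii) the bisector of an angle formed by the diagonals of $K$, or (iii) a principal axis of the John ellipse $\mathcal{E}_J(K)$ of $K$. Moreover, $$\{\alpha_1(K) : K\subset\mathbb{R}^2\text{ is a parallelogram}\}=\left[1,\sqrt{2}\right],$$ where $\alpha_1(K)=1$ precisely for rectangles and rhombuses, and $\alpha_1(K)=\sqrt{2}$ if and only if the angles between the diagonals of $K$ coincide with the interior angles of $K$ and the ratio between the length of the longer edges and that of the shorter edges of $K$ is at least $\sqrt{2}$.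
   Context: Parallelograms are non-degenerate (vertices not collinear). For an affine subspace $U\subset\mathbb{R}^2$, $P_U$ is the orthogonal projection onto $U$ and $\Phi_U(x)=2P_U(x)-x$ is the reflection across $U$. For convex bodies (compact convex sets with nonempty interior) $K,C\subset\mathbb{R}^2$, $R(K,C)=\inf\{\lambda>0 : K\subset z+\lambda C\text{ for some }z\in\mathbb{R}^2\}$. The John ellipse $\mathcal{E}_J(K)$ is the unique ellipse of maximal area contained in $K$ (for a parallelogram, it is the ellipse tangent to all edges at their midpoints); if it is a disc, every line through its center is a principal axis. The number $\alpha_1(K)$ is called the first Minkowski chirality of $K$. *)

(* Defs.v *)
From HB Require Import structures.
From mathcomp Require Import all_boot all_order all_algebra.
From mathcomp Require Import all_classical all_reals all_analysis.
Set Implicit Arguments.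
Unset Strict Implicit.
Unset Printing Implicit Defensive.
Import Order.TTheory GRing.Theory Num.Theory.
Local Open Scope classical_set_scope.
Local Open Scope ring_scope.

(* [R^o] rather than [R] gives the product its [lmodType R] structure.
   The library norm [`|x|] on a product is the max norm, hence [enorm]. *)
Notation plane R := (R^o * R^o)%type.

Definition dot (R : realType) (x y : plane R) : R := x.1 * y.1 + x.2 * y.2.

Definition enorm (R : realType) (x : plane R) : R := Num.sqrt (dot x x).

(* Unoriented angle at the vertex [y], in [0, pi]. *)
Definition angle (R : realType) (x y z : plane R) : R :=
  acos (dot (x - y) (z - y) / (enorm (x - y) * enorm (z - y))).

Definition midpoint (R : realType) (x y : plane R) : plane R :=
  (2^-1 : R) *: (x + y).

Definition line (R : realType) (p d : plane R) : set (plane R) :=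
  [set p + t *: d | t in [set: R]].

Definition is_line (R : realType) (U : set (plane R)) : Prop :=
  exists p d : plane R, d != 0 /\ U = line p d.

Definition parallel (R : realType) (U L : set (plane R)) : Prop :=
  exists z : plane R, L = [set z + x | x in U].

(* For a line [U] the foot of the perpendicular exists and is unique. *)
Definition orth_proj (R : realType) (U : set (plane R)) (x : plane R) :
  plane R :=
  xget 0 [set y | U y /\ forall z, U z -> dot (x - y) (z - y) = 0].

Definition reflection (R : realType) (U : set (plane R)) (x : plane R) :
  plane R := (2 : R) *: orth_proj U x - x.

Definition containment_radius (R : realType) (K C : set (plane R)) : R :=
  inf [set l : R | 0 < l /\
    exists z : plane R, K `<=` [set z + l *: x | x in C]].

Definition alpha1 (R : realType) (K : set (plane R)) : R :=
  inf [set containment_radius K (reflection U @` K) | U in @is_line R].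

(* [A], [B], [C], [D] are the vertices of the solid parallelogram [K], listed
   in cyclic order. A parallelogram has eight such listings, so quantifying
   existentially over them reaches every vertex, edge and diagonal. *)
Definition vertices (R : realType) (K : set (plane R)) (A B C D : plane R) :
  Prop :=
  [/\ B - A = C - D,
      forall U : set (plane R), is_line U -> ~ ([set A; B; C; D] `<=` U) &
      K = [set A + s *: (B - A) + t *: (D - A) |
            s in [set s : R | 0 <= s <= 1] & t in [set t : R | 0 <= t <= 1]]].

Definition parallelogram (R : realType) (K : set (plane R)) : Prop :=
  exists A B C D : plane R, vertices K A B C D.

Definition rectangle (R : realType) (K : set (plane R)) : Prop :=
  exists A B C D : plane R, vertices K A B C D /\ dot (B - A) (D - A) = 0.

Definition rhombus (R : realType) (K : set (plane R)) : Prop :=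
  exists A B C D : plane R,
    vertices K A B C D /\ enorm (B - A) = enorm (D - A).

(* [L] bisects the (convex) angle at [y] between the rays [yx) and [yz). *)
Definition bisector (R : realType) (x y z : plane R) (L : set (plane R)) :
  Prop :=
  [/\ is_line L, L y & exists w : plane R,
    [/\ L w, w != y, angle x y w = angle x y z / 2 &
        angle w y z = angle x y z / 2]].

Definition edge_bisector (R : realType) (K L : set (plane R)) : Prop :=
  exists A B C D : plane R, vertices K A B C D /\ bisector D A B L.

Definition diagonal_bisector (R : realType) (K L : set (plane R)) : Prop :=
  exists A B C D : plane R,
    vertices K A B C D /\ bisector A (midpoint A C) B L.

Definition interior_angles (R : realType) (K : set (plane R)) : set R :=
  [set t | exists A B C D : plane R, vertices K A B C D /\ t = angle D A B].

Definition diagonal_angles (R : realType) (K : set (plane R)) : set R :=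
  [set t | exists A B C D : plane R,
    vertices K A B C D /\ t = angle A (midpoint A C) B].

(* The solid ellipse with center [c], orthonormal axis directions [u], [v]
   and semi-axes [a], [b]. *)
Definition ellipse_with (R : realType) (c u v : plane R) (a b : R)
    (E : set (plane R)) : Prop :=
  [/\ dot u u = 1, dot v v = 1, dot u v = 0, 0 < a /\ 0 < b &
      E = [set c + (st.1 * a) *: u + (st.2 * b) *: v |
            st in [set st : R * R | st.1 ^+ 2 + st.2 ^+ 2 <= 1]]].

Definition ellipse (R : realType) (E : set (plane R)) : Prop :=
  exists (c u v : plane R) (a b : R), ellipse_with c u v a b E.

(* For a disc [u] is an arbitrary unit vector; exchanging [(u, a)] and [(v, b)]
   gives the other axis. *)
Definition principal_axis (R : realType) (E L : set (plane R)) : Prop :=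
  exists (c u v : plane R) (a b : R),
    ellipse_with c u v a b E /\ L = line c u.

Definition area (R : realType) (A : set (plane R)) : \bar R :=
  ((@lebesgue_measure R) \x (@lebesgue_measure R))%E A.

Definition john_ellipse (R : realType) (K E : set (plane R)) : Prop :=
  [/\ ellipse E, E `<=` K &
      forall E' : set (plane R), ellipse E' -> E' `<=` K -> E' <> E ->
        (area E' < area E)%E].

(* Main.v *)
(* Write K = c + {s p + t q : |s|, |t| <= 1} and let e be the unit vector
   at twice the direction angle of the line U. In the basis (p, q) the linear
   part of the reflection is a traceless matrix [[m, k], [l, -m]] that is
   linear in e and satisfies m^2 + k l = 1 and |p|^2 k - |q|^2 l = 2 (p.q) m.
   By central symmetry R(K, Phi_U(K)) is the operator norm of this matrix on
   the square, N(e) = |m| + max(|k|, |l|), so alpha_1(K) is the minimum of the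
   polygonal norm N on the unit circle. Where N is linear near e, one can move
   e along the tangent without increasing N while |e| grows; hence minimizers
   sit at the corners m = 0 (the reflection exchanges the edge directions),
   k = -l (it exchanges the diagonals) and k = l (it preserves the ellipse
   {s p + t q : s^2 + t^2 <= 1}, the John ellipse). For k = l one has
   m^2 + l^2 = 1, hence N <= sqrt 2, and the remaining claims follow by
   comparing N at the three corners. *)

Require Import Defs.
From mathcomp Require Import all_boot all_order all_algebra.
From mathcomp Require Import all_classical all_reals all_analysis.
From mathcomp Require Import measurable_realfun.
From mathcomp Require Import ring lra.
Import Order.TTheory GRing.Theory Num.Theory.
Import numFieldNormedType.Exports.
Local Open Scope classical_set_scope.
Local Open Scope ring_scope.

Set Implicit Arguments.
Unset Strict Implicit.
Unset Printing Implicit Defensive.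

(** * Area of an ellipse *)

Section Area.
Variable R : realType.
Implicit Types x y c p q d e : plane R.
Local Notation mu := (@lebesgue_measure R).

(** Each corner condition is one linear equation in e, so some unit vector satisfies it. The value
    of N there bounds alpha_1 from above, while a minimizer at an unknown corner gives the lower
    bounds; the two relations between m, k and l determine the values at each corner from |p|^2,
    |q|^2 and p.q. The John ellipse has to beat every other ellipse in Lebesgue area. To compare
    them, an ellipse is treated as the image of the disc under an arbitrary pair of vectors: its
    area is |det| times a constant that only has to be positive and finite, and containment in the
    box becomes a bound on the rows of a 2 x 2 matrix, with Hadamard's equality case giving
    uniqueness. Its axes need no diagonalization, since the minimizing reflection itself supplies
    them. Angles of K range over all listings of its vertices, while the computations fix one pair
    (p, q). The two are reconciled by the uniqueness of (p, q) up to order and signs; as signs turn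
    an angle into its supplement, cosines are compared through their squares. *)

Definition det (x y : plane R) : R := x.1 * y.2 - x.2 * y.1.

Lemma scalerE (a b : R) : a *: (b : R^o) = a * b. Proof. by []. Qed.

(** The vectors [x] and [y] need not be orthogonal: they are conjugate half-diameters, so the
    ellipse inscribed in a parallelogram can be written down before its axes are known. *)
Definition ellipsoid (c x y : plane R) : set (plane R) :=
  [set c + st.1 *: x + st.2 *: y |
    st in [set st : R * R | st.1 ^+ 2 + st.2 ^+ 2 <= 1]].

(** [Num.sqrt] is 0 on negative numbers, so this is the integral over [-1, 1], that is pi / 2.
    Comparing areas only takes that it is positive and finite. *)
Definition half_disc_area : \bar R := (\int[mu]_t (Num.sqrt (1 - t ^+ 2))%:E)%E.

Lemma continuous_semicircle : continuous (fun t : R => Num.sqrt (1 - t ^+ 2)).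
Proof.
move=> t; apply: (@continuous_comp _ _ _ (fun t : R => 1 - t ^+ 2) Num.sqrt).
  by apply: cvgB; [exact: cvg_cst|exact: exprn_continuous].
exact: sqrt_continuous.
Qed.

Lemma measurable_semicircle (D : set R) :
  measurable_fun D (@EFin R \o (fun t : R => Num.sqrt (1 - t ^+ 2))).
Proof.
apply/measurable_EFinP; apply: measurable_funTS.
exact: continuous_measurable_fun continuous_semicircle.
Qed.

Lemma half_disc_area_gt0 : (0 < half_disc_area)%E.
Proof.
have m01 : measurable (`[0, 2^-1] : set R) by exact: measurable_itv.
apply: (@lt_le_trans _ _
  (\int[mu]_(t in (`[0%R, (2^-1)%R] : set R)) (2^-1)%:E)%E).
  rewrite integral_cst//= lebesgue_measure_itv/= lte_fin invr_gt0 ltr0n.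
  by rewrite oppr0 adde0 -EFinM lte_fin mulr_gt0.
apply: (@le_trans _ _ (\int[mu]_(t in (`[0%R, (2^-1)%R] : set R))
  (Num.sqrt (1 - t ^+ 2))%:E)%E).
  apply: ge0_le_integral => //.
  - exact: measurable_semicircle.
  - move=> t /=; rewrite in_itv/= => /andP[t0 t1]; rewrite lee_fin.
    rewrite -[leLHS]ger0_norm// -sqrtr_sqr ler_sqrt; nra.
apply: ge0_subset_integral => //; exact: measurable_semicircle.
Qed.

Lemma half_disc_area_fin : half_disc_area \is a fin_num.
Proof.
rewrite ge0_fin_numE; last exact: ltW half_disc_area_gt0.
apply: (@le_lt_trans _ _ (\int[mu]_t (\1_(`[(-1)%R,
  1%R]%classic : set R) t)%:E)%E).
  apply: ge0_le_integral => //.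
  - exact: measurable_semicircle.
  - exact/measurable_EFinP.
  - move=> t _; rewrite lee_fin indicE; have [t1|t1] := boolP (t \in _).
      by rewrite -[leRHS]sqrtr1 ler_sqrt; nra.
    rewrite ler0_sqrtr//; move: t1; rewrite notin_setE/= in_itv/= => /negP.
    by rewrite negb_and -!ltNge => /orP[]; nra.
rewrite integral_indic// setIT.
rewrite [ltLHS](@lebesgue_measure_itv R `[-1, 1]) /=.
by case: ifP => _; rewrite ?ltry// -EFinB ltry.
Qed.


(* A vertical section has the length of the section of an axis-parallel ellipse
   with the same determinant. *)
Lemma xsection_ellipsoid c x y (t : R) : det x y != 0 ->
  let g : R := x.1 ^+ 2 + y.1 ^+ 2 in
  let h : R := `|det x y| / Num.sqrt g * Num.sqrt (1 - ((t - c.1) / Num.sqrt g)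
    ^+ 2) in
  let a : R := c.2 + (x.1 * x.2 + y.1 * y.2) / g * (t - c.1) in
  xsection (ellipsoid c x y) t =
    if (t - c.1) ^+ 2 <= g then `[a - h, a + h]%classic else set0.
Proof.
move=> D0 g h a.
have g0 : 0 < g.
  rewrite /g lt0r addr_ge0 ?sqr_ge0// andbT paddr_eq0 ?sqr_ge0// !sqrf_eq0.
  apply: contra D0 => /andP[/eqP x0 /eqP y0].
  by rewrite /det x0 y0 mul0r mulr0 subrr.
have sg0 : 0 < Num.sqrt g by rewrite sqrtr_gt0.
have gE : Num.sqrt g ^+ 2 = g by rewrite sqr_sqrtr// ltW.
(* If (u, v) are the disc coordinates of (t, r), Lagrange's identity makes the right side minus the
   left side equal to [det x y ^+ 2 * g * (1 - (u ^+ 2 + v ^+ 2))]. Conversely, Cramer's rule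
   recovers (u, v). *)
have mem r : xsection (ellipsoid c x y) t r <->
    (g * (r - a)) ^+ 2 <= det x y ^+ 2 * (g - (t - c.1) ^+ 2).
  have -> : g * (r - a) = g * (r - c.2) - (x.1 * x.2 + y.1 * y.2) * (t - c.1).
    by rewrite /a; field; rewrite gt_eqF.
  rewrite /xsection/= in_setE /ellipsoid/=; split.
    move=> [[u v]/= uv [<- <-]].
    rewrite -subr_ge0 [X in 0 <= X](_ : _ = det x y ^+ 2 * g * (1 - (u ^+ 2 + v
      ^+ 2))).
      by rewrite mulr_ge0// ?subr_ge0// mulr_ge0 ?sqr_ge0// ltW.
    rewrite /g/det /= /GRing.scale/=; ring.
  move=> H.
  exists ((y.2 * (t - c.1) - y.1 * (r - c.2)) / det x y,
          (x.1 * (r - c.2) - x.2 * (t - c.1)) / det x y) => /=.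
    rewrite -subr_ge0 -(pmulr_rge0 _ (_ : 0 < det x y ^+ 2 * g)); last first.
      by rewrite mulr_gt0// exprn_even_gt0.
    rewrite -subr_ge0 in H; rewrite (le_trans H)// le_eqVlt; apply/orP; left.
    apply/eqP; rewrite /g /det in D0 *; field.
    by [].
  by congr pair; rewrite /= !scalerE; rewrite /det in D0 *; field.
have memX : xsection (ellipsoid c x y) t =
    [set r | (g * (r - a)) ^+ 2 <= det x y ^+ 2 * (g - (t - c.1) ^+ 2)].
  by apply/seteqP; split=> r /mem.
have hE : (t - c.1) ^+ 2 <= g ->
    det x y ^+ 2 * (g - (t - c.1) ^+ 2) = (g * h) ^+ 2.
  move=> tg; rewrite /h !exprMn !exprVn gE !real_normK ?num_real//.
  rewrite sqr_sqrtr ?subr_ge0 ?ler_pdivrMr ?mul1r//.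
  by field; rewrite gt_eqF.
have h0 : 0 <= h by rewrite /h mulr_ge0// ?sqrtr_ge0// divr_ge0// ltW.
rewrite memX; clearbody h a; case: ifPn => tg; apply/seteqP; split => r //=.
- rewrite hE// !exprMn ler_pM2l ?exprn_gt0// -ler_sqrt ?sqr_ge0// !sqrtr_sqr.
  rewrite [leRHS]ger0_norm// in_itv/=.
  by rewrite ler_norml => /andP[h1 h2]; apply/andP; split; lra.
- rewrite in_itv/= => /andP[h1 h2].
  rewrite hE// !exprMn ler_pM2l ?exprn_gt0// -ler_sqrt ?sqr_ge0// !sqrtr_sqr.
  by rewrite [leRHS]ger0_norm// ler_norml; apply/andP; split; lra.
- move: tg; rewrite -ltNge => tg H.
  have : det x y ^+ 2 * (g - (t - c.1) ^+ 2) < 0.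
    by rewrite pmulr_rlt0 ?subr_lt0// exprn_even_gt0.
  by move=> /(le_lt_trans H); rewrite ltNge sqr_ge0.
Qed.

Lemma measurable_affine_semicircle (D : set R) (a s : R) :
  measurable_fun D (@EFin R \o (fun t => Num.sqrt (1 - ((t - a) / s) ^+ 2))).
Proof.
apply/measurable_EFinP; apply: measurable_funTS.
apply: continuous_measurable_fun => t.
apply: (@continuous_comp _ _ _ (fun t : R => (t - a) / s)
  (fun t => Num.sqrt (1 - t ^+ 2))); last exact: continuous_semicircle.
by apply: cvgM; [apply: cvgB; [exact: cvg_id|exact: cvg_cst]|exact: cvg_cst].
Qed.

Lemma affine_semicircle (a s : R) : 0 < s ->
  (\int[mu]_t (Num.sqrt (1 - ((t - a) / s) ^+ 2))%:E)%E = (s%:E *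
    half_disc_area)%E.
Proof.
move=> s0; rewrite /half_disc_area.
pose F := fun t : R => (t - a) / s.
have dF (t : R) : is_derive t (1 : R) F s^-1.
  rewrite (_ : F = s^-1 \*: (id - cst a)); last first.
    by apply/funext => u; rewrite /F /= mulrC.
  by apply: is_derive_eq; rewrite subr0 [LHS]mulr1.
have F' : (F^`()%classic) = cst s^-1.
  by apply/funext => t; rewrite derive1E; exact: derive_val.
rewrite (@increasing_ge0_integration_by_substitutionT _ F
  (fun t => Num.sqrt (1 - t ^+ 2)))//.
- rewrite F'; transitivity (s%:E * \int[mu]_t (s^-1%:E * (Num.sqrt (1 - F t ^+
    2))%:E))%E; last first.
    by congr (_ * _)%E; apply: eq_integral => t _; rewrite -EFinM mulrC.
  rewrite ge0_integralZl//=.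
  + by rewrite muleA -EFinM divff ?gt_eqF// mul1e.
  + exact: measurable_affine_semicircle.
  + by rewrite lee_fin invr_ge0 ltW.
- by move=> t u tu; rewrite /F ltr_pM2r ?invr_gt0// ltrD2r.
- by rewrite F'; exact: cst_continuous.
- by rewrite F'; exact: is_cvg_cst.
- by rewrite F'; exact: is_cvg_cst.
- apply/cvgrNyPle => A; near=> t; rewrite /F ler_pdivrMr// lerBlDr.
  by near: t; apply: nbhs_ninfty_le; exact: num_real.
- apply/cvgryPge => A; near=> t; rewrite /F ler_pdivlMr// lerBrDr.
  by near: t; apply: nbhs_pinfty_ge; exact: num_real.
- exact: continuous_semicircle.
Unshelve. all: by end_near.
Qed.

Lemma area_ellipsoid c x y : det x y != 0 ->
  area (ellipsoid c x y) = (((2 * `|det x y|)%:E) * half_disc_area)%E.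
Proof.
move=> D0; rewrite /area /product_measure1.
pose g : R := x.1 ^+ 2 + y.1 ^+ 2.
have g0 : 0 < g.
  rewrite /g lt0r addr_ge0 ?sqr_ge0// andbT paddr_eq0 ?sqr_ge0// !sqrf_eq0.
  apply: contra D0 => /andP[/eqP x0 /eqP y0].
  by rewrite /det x0 y0 mul0r mulr0 subrr.
have sg0 : 0 < Num.sqrt g by rewrite sqrtr_gt0.
transitivity (\int[mu]_t ((2 * `|det x y| / Num.sqrt g)%:E *
  (Num.sqrt (1 - ((t - c.1) / Num.sqrt g) ^+ 2))%:E))%E.
  apply: eq_integral => t _ /=.
  rewrite xsection_ellipsoid// -/g; case: ifPn => tg.
    rewrite lebesgue_measure_itv/= lte_fin.
    set h : R := `|det x y| / Num.sqrt g * _.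
    have h0 : 0 <= h by rewrite /h mulr_ge0// ?divr_ge0// ?sqrtr_ge0.
    case: ifPn => ah; rewrite -?EFinM -?EFinB; congr (_%:E).
      by rewrite /h; ring.
    transitivity (2 * h); last by rewrite /h; ring.
    by move: ah h0; rewrite -leNgt; lra.
  (* Beyond the shadow of the ellipse the section is empty, and the integrand agrees because the
     square root of a negative number is 0. *)
  rewrite measure0 [X in (_ * X%:E)%E]ler0_sqrtr ?mule0//.
  rewrite subr_le0 expr_div_n sqr_sqrtr ?(ltW g0)// ler_pdivlMr// mul1r.
  by rewrite ltW// ltNge.
rewrite ge0_integralZl//=.
  by rewrite affine_semicircle// muleA -EFinM divfK// gt_eqF.
exact: measurable_affine_semicircle.
Qed.
End Area.

(** * Reflections and containment radii *)

Section Reflection.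
Variable R : realType.
Implicit Types (x y z c d e o p q : plane R) (K : set (plane R)).

Lemma plane_eq x y : x.1 = y.1 -> x.2 = y.2 -> x = y.
Proof. by case: x y => [a b] [c d] /= -> ->. Qed.

Lemma dot_gt0 d : d != 0 -> 0 < dot d d.
Proof.
move=> d0; rewrite lt0r; apply/andP; split; last first.
  by rewrite /dot addr_ge0// -expr2 sqr_ge0.
apply: contra d0; rewrite /dot -!expr2 paddr_eq0 ?sqr_ge0// !sqrf_eq0.
by move=> /andP[/eqP d1 /eqP d2]; apply/eqP/plane_eq.
Qed.

(** For a unit vector [e] at angle t this is the reflection across the direction at angle t / 2.
    Parametrizing by [e] makes it linear in the parameter. *)
Definition refl e x : plane R :=
  (e.1 * x.1 + e.2 * x.2, e.2 * x.1 - e.1 * x.2).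

(** The square of [d] as a complex number, scaled to modulus 1. *)
Definition double_dir d : plane R :=
  ((d.1 ^+ 2 - d.2 ^+ 2) / dot d d, 2 * d.1 * d.2 / dot d d).

Lemma reflD e x y : refl e (x + y) = refl e x + refl e y.
Proof. by apply: plane_eq; rewrite /=; ring. Qed.

Lemma reflZ e a x : refl e (a *: x) = a *: refl e x.
Proof. by apply: plane_eq; rewrite /= !scalerE; ring. Qed.

Lemma reflK e x : dot e e = 1 -> refl e (refl e x) = x.
Proof.
rewrite /dot => ee; apply: plane_eq; rewrite /=.
  by rewrite -[RHS]mul1r -ee; ring.
by rewrite -[RHS]mul1r -ee; ring.
Qed.

Lemma dot_double_dir d : d != 0 -> dot (double_dir d) (double_dir d) = 1.
Proof.
move=> /dot_gt0 d0; rewrite {1}/dot/=; move: d0; rewrite /dot => d0.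
by field; rewrite gt_eqF.
Qed.

Lemma double_dir_surj e : dot e e = 1 ->
  exists2 d : plane R, d != 0 & double_dir d = e.
Proof.
move=> ee; have [e1|e1] := eqVneq (e.1 : R) (- 1).
  exists (0, 1).
    by apply/eqP => -[/eqP]; rewrite oner_eq0.
  have e2 : e.2 = 0.
    apply/eqP; rewrite -sqrf_eq0; apply/eqP.
    by move: ee; rewrite /dot e1; lra.
  apply: plane_eq; rewrite /double_dir /dot /= ?e1 ?e2; field.
  - by [].
  - by [].
have e10 : 1 + e.1 != 0 by rewrite addrC addr_eq0.
(* The sum of [e] and (1, 0) points along half the angle of [e]; it vanishes only in the case
   [e.1 = - 1] treated above. *)
exists (1 + e.1, e.2).
  by apply/eqP => -[/eqP]; rewrite (negbTE e10).
have D : dot (1 + e.1, e.2) (1 + e.1, e.2) = 2 * (1 + e.1).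
  by move: ee; rewrite /dot/=; lra.
apply: plane_eq; rewrite /double_dir D /=.
  have -> : (1 + e.1) ^+ 2 - e.2 ^+ 2 = e.1 * (2 * (1 + e.1)).
    by move: ee; rewrite /dot/=; lra.
  by rewrite mulfK// mulf_neq0.
by field.
Qed.

Lemma orth_proj_line o d x : d != 0 ->
  orth_proj (line o d) x = o + (dot (x - o) d / dot d d) *: d.
Proof.
move=> d0; have dd := dot_gt0 d0.
rewrite /orth_proj; apply: xget_unique.
  split; first by exists (dot (x - o) d / dot d d).
  move=> _ [t _ <-].
  move: dd; rewrite /dot/= !scalerE => dd; field; by rewrite gt_eqF.
(* Testing a candidate foot against the point one [d] further along the line shows that [x] minus
   the foot is orthogonal to [d], which determines the parameter. *)
move=> _ [[t _ <-] /(_ (o + (t + 1) *: d)) H].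
have {}H := H _.
have : dot (x - (o + t *: d)) d = 0.
  rewrite -[RHS]H; last by exists (t + 1).
  by rewrite /dot /= !scalerE; ring.
move=> {}H; congr (_ + _ *: _); apply: (canRL (mulfK _));
  first exact: lt0r_neq0.
by apply/eqP; rewrite eq_sym -subr_eq0 -[X in _ == X]H; apply/eqP;
  rewrite /dot /= !scalerE; ring.
Qed.

Lemma reflection_line o d x : d != 0 ->
  reflection (line o d) x = o + refl (double_dir d) (x - o).
Proof.
move=> d0; rewrite /reflection orth_proj_line//; have dd := dot_gt0 d0.
by apply: plane_eq; move: dd; rewrite /double_dir /refl /dot/= !scalerE => dd;
  field; rewrite gt_eqF.
Qed.

Definition box c p q : set (plane R) :=
  [set c + s *: p + t *: q | s in [set s : R | `|s| <= 1] &
                             t in [set t : R | `|t| <= 1]].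

Lemma det_decomp p q x : det p q != 0 ->
  x = (det x q / det p q) *: p + (det p x / det p q) *: q.
Proof.
by move=> D0; apply: plane_eq; rewrite /= !scalerE; move: D0;
  rewrite /det => D0; field.
Qed.

Lemma mem_box c p q x : det p q != 0 ->
  box c p q x <-> `|det (x - c) q| <= `|det p q| /\ `|det p (x - c)| <= `|det p
    q|.
Proof.
move=> D0; have D1 : 0 < `|det p q| by rewrite normr_gt0.
split.
  move=> [s /= s1 [t /= t1 <-]].
  have -> : det (c + s *: p + t *: q - c) q = s * det p q.
    by rewrite /det /= !scalerE; ring.
  have -> : det p (c + s *: p + t *: q - c) = t * det p q.
    by rewrite /det /= !scalerE; ring.
  by rewrite !normrM !ler_piMl.
move=> [h1 h2]; exists (det (x - c) q / det p q).
  by rewrite /= normrM normfV ler_pdivrMr// mul1r.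
exists (det p (x - c) / det p q).
  by rewrite /= normrM normfV ler_pdivrMr// mul1r.
by rewrite -addrA -det_decomp// addrC subrK.
Qed.

(* The matrix of [refl e] in the basis [p], [q] is [[m, k], [l, -m]]. *)
Definition mxm p q e : R := det (refl e p) q / det p q.
Definition mxk p q e : R := det (refl e q) q / det p q.
Definition mxl p q e : R := det p (refl e p) / det p q.

Definition mxnorm p q e : R :=
  `|mxm p q e| + Num.max `|mxk p q e| `|mxl p q e|.

Lemma refl_basisl p q e : det p q != 0 ->
  refl e p = mxm p q e *: p + mxl p q e *: q.
Proof. exact: det_decomp. Qed.

Lemma refl_basisr p q e : det p q != 0 ->
  refl e q = mxk p q e *: p - mxm p q e *: q.
Proof.
move=> D0; rewrite [LHS](det_decomp _ D0) -scaleNr; congr (_ + _ *: _).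
by move: D0; rewrite /mxm /det /= => D0; field.
Qed.

(** A reflection has determinant -1, in any basis. *)
Lemma mx_det p q e : det p q != 0 -> dot e e = 1 ->
  mxm p q e ^+ 2 + mxk p q e * mxl p q e = 1.
Proof.
by move=> D0 <-; move: D0; rewrite /mxm /mxk /mxl /det /dot /= => D0; field.
Qed.

(** A reflection is self-adjoint: expand [dot p (refl e q) = dot (refl e p) q] in the basis. *)
Lemma mx_sym p q e : det p q != 0 ->
  dot p p * mxk p q e - dot q q * mxl p q e = 2 * dot p q * mxm p q e.
Proof.
by move=> D0; move: D0; rewrite /mxm /mxk /mxl /det /dot /= => D0; field.
Qed.

(** With M the larger of |k| and |l|, 1 = m^2 + k l <= |m|^2 + M^2 <= (|m| + M)^2. *)
Lemma mxnorm_ge1 p q e : det p q != 0 -> dot e e = 1 -> 1 <= mxnorm p q e.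
Proof.
move=> D0 e1; have := mx_det D0 e1; rewrite /mxnorm.
move: (mxm p q e) (mxk p q e) (mxl p q e) => m k l H.
set M := Num.max _ _.
have kM : `|k| <= M by rewrite le_max lexx.
have lM : `|l| <= M by rewrite le_max lexx orbT.
have M0 : 0 <= M by exact: le_trans kM.
have : 1 <= `|m| ^+ 2 + `|k| * `|l|.
  by rewrite -H lerD// -?normrM ?ler_norm// real_normK ?num_real.
have : `|k| * `|l| <= M * M by rewrite ler_pM.
have := normr_ge0 m; nra.
Qed.

Lemma containment_box c p q o d : det p q != 0 -> d != 0 ->
  containment_radius (box c p q) (reflection (line o d) @` box c p q) =
  mxnorm p q (double_dir d).
Proof.
move=> D0 d0; have rE x := reflection_line o x d0.
have e1 := dot_double_dir d0.
move: (double_dir d) rE e1 => e rE e1; set N := mxnorm p q e.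
have N1 : 1 <= N by exact: mxnorm_ge1.
have D1 : 0 < `|det p q| by rewrite normr_gt0.
rewrite /containment_radius.
rewrite (_ : [set l | _] = `[N, +oo[%classic) ?inf_itv//.
apply/seteqP; split=> l /=; rewrite in_itv/= ?andbT.
  move=> [l0 [z zK]].
  (* Subtracting the inclusions of the antipodal points [c + xi] and [c - xi] cancels [z] and the
     offset [o] of the line; half the difference of two points of the symmetric box is again in it,
     up to centring. *)
  have key s t : `|s| <= 1 -> `|t| <= 1 ->
      `|det (refl e (s *: p + t *: q)) q| <= l * `|det p q| /\
      `|det p (refl e (s *: p + t *: q))| <= l * `|det p q|.
    move=> s1 t1; set xi := s *: p + t *: q.
    have [_ [y yK <-] yE] : [set z + l *: x | x in reflection (line o d) @` box
      c p q] (c + xi).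
      by apply: zK; exists s => //; exists t => //; rewrite addrA.
    have [_ [y' yK' <-] yE'] : [set z + l *: x | x in reflection (line o d) @`
      box c p q] (c - xi).
      by apply: zK; exists (- s); rewrite /= ?normrN//; exists (- t);
        rewrite /= ?normrN// !scaleNr -addrA -opprD.
    have E : refl e xi = (l / 2) *: ((y - c) - (y' - c)).
      have : xi = (l / 2) *: refl e ((y - c) - (y' - c)).
        transitivity ((2^-1 : R) *: ((c + xi) - (c - xi))).
          by apply: plane_eq; rewrite /= !scalerE; field.
        rewrite -yE -yE' !rE.
        by apply: plane_eq; rewrite /= !scalerE; field.
      by move=> {1}->; rewrite reflZ reflK.
    have [y1 y2] := (mem_box c y D0).1 yK.
    have [y1' y2'] := (mem_box c y' D0).1 yK'.
    have El x : det (refl e xi) x = l / 2 * (det (y - c) x - det (y' - c) x).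
      by rewrite E /det /= !scalerE; ring.
    have Er x : det x (refl e xi) = l / 2 * (det x (y - c) - det x (y' - c)).
      by rewrite E /det /= !scalerE; ring.
    rewrite El Er !normrM (gtr0_norm l0) normfV (@ger0_norm _ 2)//.
    have h u v : `|u| <= `|det p q| -> `|v| <= `|det p q| ->
      l / 2 * `|u - v| <= l * `|det p q|.
      move=> u1 v1; have := ler_normB u v => uv.
      rewrite -mulrA ler_pM2l// ler_pdivrMl// (le_trans uv)//.
      by rewrite mulr_natl mulr2n lerD.
    by split; apply: h.
  have n1 : `|1 : R| <= 1 by rewrite normr1.
  have nN1 : `|-1 : R| <= 1 by rewrite normrN1.
  (* Two adjacent vertices suffice: they give |m + k| and |m - k|, hence |m| + |k|, and likewise |l|
     + |m|. *)
  have [a1 a2] := key 1 1 n1 n1; have [b1 b2] := key 1 (-1) n1 nN1.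
  have El s t : det (refl e (s *: p + t *: q)) q = (s * mxm p q e + t * mxk p q
    e) * det p q.
    rewrite reflD !reflZ (refl_basisl e D0) (refl_basisr e D0).
    by rewrite /det /= !scalerE; ring.
  have Er s t : det p (refl e (s *: p + t *: q)) = (s * mxl p q e - t * mxm p q
    e) * det p q.
    rewrite reflD !reflZ (refl_basisl e D0) (refl_basisr e D0).
    by rewrite /det /= !scalerE; ring.
  move: a1 a2 b1 b2; rewrite !El !Er !normrM !ler_pM2r// !mul1r !mulN1r opprK.
  move=> a1 a2 b1 b2; rewrite /N /mxnorm.
  have sm (u v : R) : `|u + v| <= l -> `|u - v| <= l -> `|u| + `|v| <= l.
    by rewrite !ler_norml => /andP[? ?] /andP[? ?]; case: (ger0P u);
      case: (ger0P v); lra.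
  rewrite addr_maxr ge_max; apply/andP; split; first exact: sm.
  by rewrite addrC; apply: sm.
move=> Nl; have l0 : 0 < l by apply: lt_le_trans Nl; exact: lt_le_trans N1.
split => //.
(* This translation brings the centre of the scaled mirror image back to [c]. *)
exists (c - l *: (reflection (line o d) c)) => x [s s1 [t t1 <-]].
set xi := s *: p + t *: q.
exists (reflection (line o d) (c + l^-1 *: refl e xi)).
  exists (c + l^-1 *: refl e xi) => //.
  apply/mem_box => //; rewrite addrC addKr.
  rewrite reflD !reflZ (refl_basisl e D0) (refl_basisr e D0).
  set m := mxm _ _ _; set k := mxk _ _ _; set r := mxl _ _ _.
  have -> : det (l^-1 *: (s *: (m *: p + r *: q) + t *: (k *: p - m *: q))) q =
     l^-1 * (s * m + t * k) * det p q by rewrite /det /= !scalerE; ring.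
  have -> : det p (l^-1 *: (s *: (m *: p + r *: q) + t *: (k *: p - m *: q))) =
     l^-1 * (s * r - t * m) * det p q by rewrite /det /= !scalerE; ring.
  have h (u v : R) : `|u| + `|v| <= N ->
      `|l^-1 * (s * u + t * v) * det p q| <= `|det p q|.
    move=> uv; rewrite normrM ler_piMl// normrM normfV (gtr0_norm l0)
      ler_pdivrMl// mulr1.
    rewrite (le_trans _ Nl)// (le_trans _ uv)// (le_trans (ler_normD _ _))//.
    by rewrite !normrM lerD// ler_piMl.
  split; first by apply: h; rewrite lerD2l le_max lexx.
  by rewrite -mulrN; apply: h; rewrite normrN addrC lerD2l le_max lexx orbT.
have E : refl e (c + l^-1 *: refl e xi - o) = refl e (c - o) + l^-1 *: xi.
  by rewrite (addrAC c) [LHS]reflD [X in _ + X]reflZ reflK.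
rewrite !rE E (_ : c + s *: p + t *: q = c + xi) -?addrA//.
move: (refl e (c - o)) => w; clearbody xi.
by apply: plane_eq; rewrite /= !scalerE; field; rewrite gt_eqF.
Qed.
End Reflection.

(** * Minimizing over the unit circle *)

Section Minimization.
Variable R : realType.
Implicit Types (x y z c d e o p q : plane R) (K : set (plane R)).

Lemma normrD_small (m u : R) : `|u| <= `|m| -> `|m + u| = `|m| + Num.sg m * u.
Proof.
case: (sgrP m) => m0 um.
- by rewrite normr_le0 in um; rewrite (eqP um) m0 mulr0 !addr0 normr0.
- by move: um; rewrite ler_norml => /andP[u1 u2]; rewrite ger0_norm; lra.
- by move: um; rewrite ler_norml => /andP[u1 u2]; rewrite ler0_norm; lra.
Qed.

(** As m and k are nonzero and the maximum is attained by |k| alone, the norm is affine for small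
    [t], with slope [g]; taking [t] of sign opposite to [g] does not increase it. *)
Lemma mxnorm_descent (m k l m' k' l' : R) : m != 0 -> `|l| < `|k| ->
  exists2 t, t != 0 &
    `|m + t * m'| + Num.max `|k + t * k'| `|l + t * l'| <=
    `|m| + Num.max `|k| `|l|.
Proof.
move=> m0 lk.
pose g := Num.sg m * m' + Num.sg k * k'.
pose s := 1 + `|m'| + `|k'| + `|l'|.
have s0 : 0 < s by rewrite /s !(ltr_wpDr _ _)//.
(* Since [s] dominates |m'| and |k'| + |l'|, a shift of size [b] changes neither the signs of m and
   k nor which term attains the maximum. *)
pose b := Num.min `|m| (`|k| - `|l|) / s.
have b0 : 0 < b by rewrite divr_gt0// lt_min normr_gt0 m0 subr_gt0.
have bs : b * s = Num.min `|m| (`|k| - `|l|) by rewrite divfK ?gt_eqF.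
have bm : b * s <= `|m| by rewrite bs ge_min lexx.
have bk : b * s <= `|k| - `|l| by rewrite bs ge_min lexx orbT.
pose t := if 0 <= g then - b else b.
have tb : `|t| = b by rewrite /t; case: ifP; rewrite ?normrN gtr0_norm.
have tg : t * g <= 0.
  rewrite /t; case: ifPn => g0; first by rewrite mulNr oppr_le0 mulr_ge0// ltW.
  by rewrite -ltNge in g0; rewrite nmulr_lle0// ltW.
have t0 : t != 0 by rewrite -normr_gt0 tb.
exists t => //.
have um : `|t * m'| <= `|m|.
  by rewrite normrM tb (le_trans _ bm)// ler_pM2l// /s -!addrA;
    have := normr_ge0 k'; have := normr_ge0 l'; lra.
have vw : `|t * k'| + `|t * l'| <= `|k| - `|l|.
  by rewrite !normrM tb (le_trans _ bk)// -mulrDr ler_pM2l// /s;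
    have := normr_ge0 m'; lra.
have uv : Num.sg m * (t * m') + Num.sg k * (t * k') <= 0.
  by apply: le_trans tg; rewrite /g; lra.
move: um vw uv; move: (t * m') (t * k') (t * l') => u v w um vw uv.
have k0 : k != 0 by rewrite -normr_gt0 (le_lt_trans _ lk).
rewrite (max_idPl (ltW lk)).
have -> : Num.max `|k + v| `|l + w| = `|k + v|.
  apply/max_idPl; rewrite (le_trans (ler_normD _ _))//.
  by have := lerB_normD k v; lra.
have vk : `|v| <= `|k| by have := normr_ge0 w; have := normr_ge0 l; lra.
by rewrite !normrD_small//; lra.
Qed.

Lemma mxmE p q e (t : R) e' : mxm p q (e + t *: e') = mxm p q e + t * mxm p q
  e'.
Proof. by rewrite /mxm mulrA -mulrDl /det /= !scalerE; congr (_ / _); ring. Qed.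

Lemma mxkE p q e (t : R) e' : mxk p q (e + t *: e') = mxk p q e + t * mxk p q
  e'.
Proof. by rewrite /mxk mulrA -mulrDl /det /= !scalerE; congr (_ / _); ring. Qed.

Lemma mxlE p q e (t : R) e' : mxl p q (e + t *: e') = mxl p q e + t * mxl p q
  e'.
Proof. by rewrite /mxl mulrA -mulrDl /det /= !scalerE; congr (_ / _); ring. Qed.

Lemma mxnormZ p q e (t : R) : mxnorm p q (t *: e) = `|t| * mxnorm p q e.
Proof.
rewrite -[t *: e]add0r /mxnorm mxmE mxkE mxlE.
have -> : mxm p q 0 = 0 by rewrite /mxm /det /=; ring.
have -> : mxk p q 0 = 0 by rewrite /mxk /det /=; ring.
have -> : mxl p q 0 = 0 by rewrite /mxl /det /=; ring.
by rewrite !add0r !normrM mulrDr maxr_pMr.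
Qed.

Lemma mxnorm_minimizer p q e : det p q != 0 -> dot e e = 1 ->
  (forall e', dot e' e' = 1 -> mxnorm p q e <= mxnorm p q e') ->
  [\/ mxm p q e = 0, mxk p q e = mxl p q e | mxk p q e = - mxl p q e].
Proof.
move=> D0 e1 emin.
have [->|m0] := eqVneq (mxm p q e) 0; first exact: Or31.
pose e' : plane R := (- e.2, e.1).
have [t t0 Nt] : exists2 t, t != 0 & mxnorm p q (e + t *: e') <= mxnorm p q e \/
    `|mxk p q e| = `|mxl p q e|.
  rewrite /mxnorm.
  have [kl|kl|kl] := ltgtP `|mxk p q e| `|mxl p q e|.
  - have [t t0 H] := mxnorm_descent (mxm p q e') (mxl p q e') (mxk p q e') m0
      kl.
    by exists t => //; left; rewrite mxmE mxkE mxlE [X in _ + X <= _]maxC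
      (le_trans H)// (max_idPl (ltW kl)).
  - have [t t0 H] := mxnorm_descent (mxm p q e') (mxk p q e') (mxl p q e') m0
      kl.
    by exists t => //; left; rewrite mxmE mxkE mxlE (le_trans H)// (max_idPl
      (ltW kl)).
  - by exists 1; rewrite ?oner_eq0//; right.
case: Nt => [Nt|/eqP]; last first.
  by rewrite eqr_norm2 => /orP[]/eqP ->; [exact: Or32|exact: Or33].
(* As [e'] is a unit vector orthogonal to [e], this is the squared length of the moved vector.
   Normalizing divides its norm by [Num.sqrt r > 1], which beats the minimum because the norm at [e]
   is at least 1, hence positive. *)
pose r := 1 + t ^+ 2.
have r1 : 1 < r by rewrite /r ltrDl exprn_even_gt0.
have sr1 : 1 < Num.sqrt r by rewrite -[ltLHS]sqrtr1 ltr_sqrt// (lt_trans _ r1).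
have sr0 : 0 < Num.sqrt r by rewrite (lt_trans _ sr1).
have : dot ((Num.sqrt r)^-1 *: (e + t *: e')) ((Num.sqrt r)^-1 *: (e + t *: e'))
  = 1.
  have -> : dot ((Num.sqrt r)^-1 *: (e + t *: e')) ((Num.sqrt r)^-1 *: (e + t *:
    e'))
      = (Num.sqrt r ^+ 2)^-1 * ((1 + t ^+ 2) * dot e e).
    by rewrite /dot /= !scalerE; field; rewrite gt_eqF.
  by rewrite e1 sqr_sqrtr ?mulr1 ?mulVf// ?gt_eqF ?ltW// (lt_trans _ r1).
move=> /emin; rewrite mxnormZ ger0_norm ?invr_ge0 ?(ltW sr0)//.
rewrite ler_pdivlMl// => H.
have N1 := mxnorm_ge1 D0 e1.
have := le_trans H Nt; rewrite ler_piMl ?(le_trans _ N1)//; nra.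
Qed.

(** On the unit circle every matrix entry is a combination of [cos t] and [sin t], so the extreme
    value theorem applies on [-pi, pi]. *)
Lemma mxnorm_min_exists p q : exists2 e, dot e e = 1 &
  forall e', dot e' e' = 1 -> mxnorm p q e <= mxnorm p q e'.
Proof.
pose E (t : R) : plane R := (cos t, sin t).
have E1 t : dot (E t) (E t) = 1 by rewrite /dot /= -!expr2 cos2Dsin2.
have mE t : forall (a b : R), {for t,
  continuous (fun t : R => a * cos t + b * sin t)}.
  move=> a b; apply: cvgD; apply: cvgM; first exact: cvg_cst.
  - exact: continuous_cos.
  - exact: cvg_cst.
  - exact: continuous_sin.
have cm : continuous (fun t => mxm p q (E t)).
  move=> t; rewrite (_ : (fun t => _) =
    (fun t : R => (mxm p q (1, 0)) * cos t + mxm p q (0, 1) * sin t)).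
    exact: mE.
  by apply/funext => u; rewrite /mxm /det /=; ring.
have ck : continuous (fun t => mxk p q (E t)).
  move=> t; rewrite (_ : (fun t => _) =
    (fun t : R => (mxk p q (1, 0)) * cos t + mxk p q (0, 1) * sin t)).
    exact: mE.
  by apply/funext => u; rewrite /mxk /det /=; ring.
have cl : continuous (fun t => mxl p q (E t)).
  move=> t; rewrite (_ : (fun t => _) =
    (fun t : R => (mxl p q (1, 0)) * cos t + mxl p q (0, 1) * sin t)).
    exact: mE.
  by apply/funext => u; rewrite /mxl /det /=; ring.
have cN : continuous (fun t => mxnorm p q (E t)).
  move=> t; apply: cvgD; first by apply: cvg_norm; exact: cm.
  apply: (@continuous_max R _ (fun t => `|mxk p q (E t)|) (fun t => `|mxl p q (E
    t)|)).
    by apply: cvg_norm; exact: ck.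
  by apply: cvg_norm; exact: cl.
have [||t _ tmin] := @EVT_min R (fun t => mxnorm p q (E t)) (- pi) pi.
  - by rewrite (le_trans _ (pi_ge0 _))// oppr_le0 pi_ge0.
  - exact: continuous_subspaceT.
exists (E t) => // e' e1.
have [u uI ->] : exists2 u, u \in `[- pi, pi]%R & e' = E u.
  have e11 : -1 <= e'.1 <= 1.
    rewrite -ler_norml -(@expr_le1 _ 2)// real_normK ?num_real//.
    by rewrite -e1 /dot expr2 lerDl -expr2 sqr_ge0.
  have s2 : e'.2 ^+ 2 = 1 - e'.1 ^+ 2 by move: e1; rewrite /dot; lra.
  have := acos_ge0 e11; have := acos_lepi e11 => a1 a0.
  have [s0|s0] := lerP 0 (e'.2 : R).
    exists (acos e'.1); first by rewrite in_itv/= a1 (le_trans _ a0)// oppr_le0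
      pi_ge0.
    apply: plane_eq; rewrite /= ?acosK ?in_itv//.
    by rewrite sin_acos// -s2 sqrtr_sqr ger0_norm.
  exists (- acos e'.1); first by rewrite in_itv/= lerN2 a1 (le_trans _ (pi_ge0
    _))// oppr_le0.
  apply: plane_eq; rewrite /= ?cosN ?acosK ?in_itv// sinN.
  by rewrite sin_acos// -s2 sqrtr_sqr ltr0_norm// opprK.
exact: tmin.
Qed.

End Minimization.

(** * Vertices of a parallelogram *)

Section Vertices.
Variable R : realType.
Implicit Types (x y z c d e o p q : plane R) (K : set (plane R)).

Lemma inf_minimum (S : set R) (m : R) : S m -> lbound S m -> inf S = m.
Proof.
move=> Sm mS; apply/eqP; rewrite eq_le; apply/andP; split.
  by apply: ge_inf => //; exists m.
by apply: lb_le_inf => //; exists m.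
Qed.

Lemma alpha1_box c p q : det p q != 0 -> exists e,
  [/\ dot e e = 1, alpha1 (box c p q) = mxnorm p q e &
      forall e', dot e' e' = 1 -> mxnorm p q e <= mxnorm p q e'].
Proof.
move=> D0; have [e e1 emin] := mxnorm_min_exists p q.
exists e; split => //; apply: inf_minimum.
  have [d d0 de] := double_dir_surj e1.
  by exists (line 0 d); [exists 0, d|rewrite containment_box// de].
move=> _ [_ [r [d [d0 ->]]] <-]; rewrite containment_box//.
exact/emin/dot_double_dir.
Qed.

Lemma vertices_box c p q : det p q != 0 ->
  vertices (box c p q) (c - p - q) (c + p - q) (c + p + q) (c - p + q).
Proof.
move=> D0; split.
- by apply: plane_eq => /=; ring.
- move=> U [r [d [d0 ->]]] H.
  have [t _ At] : line r d (c - p - q) by apply: H; left; left; left.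
  have [u _ Bu] : line r d (c + p - q) by apply: H; left; left; right.
  have [v _ Dv] : line r d (c - p + q) by apply: H; right.
  have : det ((c + p - q) - (c - p - q)) ((c - p + q) - (c - p - q)) = 0.
    by rewrite -At -Bu -Dv /det /= !scalerE; ring.
  move=> E; move/eqP: D0; apply.
  transitivity (4^-1 * (det ((c + p - q) - (c - p - q)) ((c - p + q) - (c - p -
    q)))).
    by rewrite /det/=; field.
  by rewrite E mulr0.
- apply/seteqP; split => x.
    move=> [s s1 [t t1 <-]].
    exists ((1 + s) / 2); first by move: s1; rewrite /= ler_norml; lra.
    exists ((1 + t) / 2); first by move: t1; rewrite /= ler_norml; lra.
    by apply: plane_eq; rewrite /= !scalerE; field.
  move=> [s s1 [t t1 <-]].
  exists (2 * s - 1); first by move: s1; rewrite /= ler_norml; lra.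
  exists (2 * t - 1); first by move: t1; rewrite /= ler_norml; lra.
  by apply: plane_eq; rewrite /= !scalerE; field.
Qed.

Lemma det_eq0_collinear x y : det x y = 0 ->
  exists2 d, d != 0 & (exists t, x = t *: d) /\ (exists t, y = t *: d).
Proof.
move=> D0; have [x0|x0] := eqVneq x 0; last first.
  exists x => //; split; first by exists 1; rewrite scale1r.
  exists (dot x y / dot x x); have := dot_gt0 x0; move: D0;
    rewrite /det /dot => D0 dx.
  apply: plane_eq; rewrite /= !scalerE; apply: (mulIf (lt0r_neq0 dx)).
    by rewrite mulrAC divfK ?gt_eqF//; have := congr1 ( *%R x.2) D0; lra.
  by rewrite mulrAC divfK ?gt_eqF//; have := congr1 ( *%R x.1) D0; lra.
have [y0|y0] := eqVneq y 0.
  exists (1, 0); first by apply/eqP => -[/eqP]; rewrite oner_eq0.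
  by split; exists 0; rewrite ?x0 ?y0 scale0r.
by exists y => //; split; [exists 0; rewrite x0 scale0r|exists 1;
  rewrite scale1r].
Qed.

(** The passage from listings of vertices to a centre and two half-edge vectors, in which all
    computations are done. *)
Lemma vertices_boxP K A B C D : vertices K A B C D <-> exists c p q,
  [/\ det p q != 0, K = box c p q, A = c - p - q, B = c + p - q &
      C = c + p + q /\ D = c - p + q].
Proof.
split; last by move=> [c [p [q [D0 -> -> -> [-> ->]]]]]; exact: vertices_box.
move=> [BA ncol KE].
pose p := (2^-1 : R) *: (B - A); pose q := (2^-1 : R) *: (D - A).
pose c := A + p + q.
have CE : C = B + D - A by rewrite addrAC BA subrK.
have cA : A = c - p - q by apply: plane_eq; rewrite /=; ring.
have cB : B = c + p - q by apply: plane_eq; rewrite /= !scalerE; field.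
have cC : C = c + p + q by rewrite CE; apply: plane_eq; rewrite /= !scalerE;
  field.
have cD : D = c - p + q by apply: plane_eq; rewrite /= !scalerE; field.
have D0 : det p q != 0.
  apply/eqP => /det_eq0_collinear [d d0 [[t pt] [u qu]]].
  apply: (ncol (line A d)); first by exists A, d.
  move=> x [[[->|->]|->]|->].
  - by exists 0 => //; rewrite scale0r addr0.
  - by exists (2 * t) => //; rewrite -scalerA -pt cB cA; apply: plane_eq;
      rewrite /= !scalerE; ring.
  - by exists (2 * t + 2 * u) => //; rewrite scalerDl -!scalerA -pt -qu cC cA;
      apply: plane_eq; rewrite /= !scalerE; ring.
  - by exists (2 * u) => //; rewrite -scalerA -qu cD cA; apply: plane_eq;
      rewrite /= !scalerE; ring.
exists c, p, q; split => //.
have [_ _ ->] := vertices_box c D0.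
by rewrite -cA -cB -cD.
Qed.

Lemma parallelogram_boxP K :
  parallelogram K <-> exists c p q, det p q != 0 /\ K = box c p q.
Proof.
split.
  by move=> [A [B [C [D /vertices_boxP[c [p [q [D0 KE _ _ _]]]]]]]];
    exists c, p, q.
by move=> [c [p [q [D0 ->]]]]; do 4!eexists; exact: vertices_box.
Qed.

Lemma box_swap c p q : box c q p = box c p q.
Proof.
by apply/seteqP; split=> x [s s1 [t t1 <-]]; exists t => //; exists s => //;
  rewrite addrAC.
Qed.

Lemma box_opp c p q : box c (- p) q = box c p q.
Proof.
by apply/seteqP; split=> x [s s1 [t t1 <-]]; exists (- s); rewrite /= ?normrN//;
  exists t => //; rewrite ?scalerN scaleNr ?opprK.
Qed.

Lemma det_swap x y : det y x = - det x y.
Proof. by rewrite /det; ring. Qed.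

(** The four vertices of the inner box realize all sign choices, so the offset between the centres
    drops out and the absolute values add up. *)
Lemma box_subset c p q c' p' q' : det p q != 0 -> box c' p' q' `<=` box c p q ->
  `|det p' q| + `|det q' q| <= `|det p q| /\ `|det p p'| + `|det p q'| <= `|det
    p q|.
Proof.
move=> D0 sub.
have key s t : `|s| <= 1 -> `|t| <= 1 ->
    `|det (c' - c) q + (s * det p' q + t * det q' q)| <= `|det p q| /\
    `|det p (c' - c) + (s * det p p' + t * det p q')| <= `|det p q|.
  move=> s1 t1; have : box c' p' q' (c' + s *: p' + t *: q') by exists s => //;
    exists t.
  move=> /sub /(mem_box c _ D0).
  have -> : det (c' + s *: p' + t *: q' - c) q = det (c' - c) q + (s * det p' q
    + t * det q' q).
    by rewrite /det /= !scalerE; ring.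
  suff -> : det p (c' + s *: p' + t *: q' - c) = det p (c' - c) + (s * det p p'
    + t * det p q') by [].
  by rewrite /det /= !scalerE; ring.
have n1 : `|1 : R| <= 1 by rewrite normr1.
have nN1 : `|-1 : R| <= 1 by rewrite normrN1.
have [a1 b1] := key _ _ n1 n1; have [a2 b2] := key _ _ n1 nN1.
have [a3 b3] := key _ _ nN1 n1; have [a4 b4] := key _ _ nN1 nN1.
move: a1 a2 a3 a4 b1 b2 b3 b4; rewrite !ler_norml.
move: `|det p q| (det (c' - c) q) (det p (c' - c)) => M u v.
move=> a1 a2 a3 a4 b1 b2 b3 b4; split.
  by clear b1 b2 b3 b4; case: (ger0P (det p' q)); case: (ger0P (det q' q)); lra.
by clear a1 a2 a3 a4; case: (ger0P (det p p')); case: (ger0P (det p q')); lra.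
Qed.

(** The variables stand for the absolute entries of a change of basis and of its determinant; the
    first two sum bounds express one inclusion of boxes, the other two the reverse one. Multiplying
    the latter gives m <= m^2, so 1 <= m; multiplying the former then forces x y = z w = 0, leaving
    only signed permutation matrices. *)
Lemma unimodular_l1 (x y z w m : R) :
  0 <= x -> 0 <= y -> 0 <= z -> 0 <= w ->
  x + z <= 1 -> y + w <= 1 -> w + z <= m -> y + x <= m ->
  0 < m -> m <= x * w + y * z ->
  x = 0 /\ w = 0 /\ y = 1 /\ z = 1 \/ y = 0 /\ z = 0 /\ x = 1 /\ w = 1.
Proof.
move=> x0 y0 z0 w0 k1 k2 k3 k4 m0 mT.
have P1 : (x + z) * (y + w) <= 1.
  by rewrite -[leRHS]mulr1 ler_pM// addr_ge0.
have P2 : (w + z) * (y + x) <= m * m by rewrite ler_pM// addr_ge0.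
have xy := mulr_ge0 x0 y0; have zw := mulr_ge0 z0 w0.
have wy := mulr_ge0 w0 y0; have zx := mulr_ge0 z0 x0.
have m1 : 1 <= m.
  rewrite -(ler_pM2l m0) mulr1; apply: le_trans P2.
  by rewrite (_ : (w + z) * (y + x) = x * w + y * z + (w * y + z * x));
    [lra|ring].
have E : (x + z) * (y + w) = x * w + y * z + x * y + z * w by ring.
have xy0 : x * y = 0 by rewrite E in P1; lra.
have zw0 : z * w = 0 by rewrite E in P1; lra.
move/eqP: xy0; rewrite mulf_eq0 => /orP[]/eqP E0;
  rewrite E0 in k1 k2 k3 k4 mT zw0 *.
  have y1 : y = 1.
    apply/eqP; rewrite eq_le; apply/andP; split; first by lra.
    by have := ler_wpM2l y0 (_ : z <= 1); rewrite mulr1 => h;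
      have := h ltac:(lra); lra.
  have z1 : z = 1 by rewrite y1 in mT; lra.
  by left; rewrite y1 z1 mul1r in zw0 *.
have x1 : x = 1.
  apply/eqP; rewrite eq_le; apply/andP; split; first by lra.
  by have := ler_wpM2l x0 (_ : w <= 1); rewrite mulr1 => h;
    have := h ltac:(lra); lra.
have w1 : w = 1 by rewrite x1 in mT; lra.
by right; rewrite x1 w1 mulr1 in zw0 *.
Qed.

Lemma box_inj c p q c' p' q' : det p q != 0 -> det p' q' != 0 ->
  box c p q = box c' p' q' -> exists s t : R, [/\ s ^+ 2 = 1, t ^+ 2 = 1 &
    (p' = s *: p /\ q' = t *: q) \/ (p' = s *: q /\ q' = t *: p)].
Proof.
move=> D0 D0' E.
have [h1 h2] : `|det p' q| + `|det q' q| <= `|det p q| /\ `|det p p'| + `|det p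
  q'| <= `|det p q|.
  by apply: (@box_subset c _ _ c') => //; rewrite E.
have [h3 h4] : `|det p q'| + `|det q q'| <= `|det p' q'| /\ `|det p' p| + `|det
  p' q| <= `|det p' q'|.
  by apply: (@box_subset c' _ _ c) => //; rewrite E.
have pE := det_decomp p' D0; have qE := det_decomp q' D0.
move: pE qE.
set a := det p' q / _; set b := det p p' / _; set g := det q' q / _;
  set d := det p q' / _ => pE qE.
have DE : det p' q' = (a * d - b * g) * det p q by rewrite pE qE /det /=
  !scalerE; ring.
have D1 : 0 < `|det p q| by rewrite normr_gt0.
have D1' : 0 < `|det p' q'| by rewrite normr_gt0.
have nE u : `|u / det p q| * `|det p q| = `|u| by rewrite -normrM divfK.
have k1 : `|a| + `|g| <= 1.
  by rewrite -(ler_pM2r D1) mulrDl !nE mul1r.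
have k2 : `|b| + `|d| <= 1.
  by rewrite -(ler_pM2r D1) mulrDl !nE mul1r.
have k3 : `|d| + `|g| <= `|a * d - b * g|.
  by rewrite -(ler_pM2r D1) mulrDl !nE -normrM -DE -(normrN (det q' q))
    -det_swap.
have k4 : `|b| + `|a| <= `|a * d - b * g|.
  by rewrite -(ler_pM2r D1) mulrDl !nE -normrM -DE -(normrN (det p p'))
    -det_swap.
have DD : 0 < `|a * d - b * g|.
  by rewrite normr_gt0; apply: contra D0'; rewrite DE => /eqP ->; rewrite mul0r.
have DT : `|a * d - b * g| <= `|a| * `|d| + `|b| * `|g|.
  by rewrite -!normrM ler_normB.
have norm_sq (r : R) : `|r| = 1 -> r ^+ 2 = 1.
  by move=> r1; rewrite -real_normK ?num_real// r1 expr1n.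
have [ab0|b0] : `|a| = 0 /\ `|d| = 0 /\ `|b| = 1 /\ `|g| = 1 \/
            `|b| = 0 /\ `|g| = 0 /\ `|a| = 1 /\ `|d| = 1.
- exact: unimodular_l1 (normr_ge0 a) (normr_ge0 b) (normr_ge0 g) (normr_ge0 d)
    k1 k2 k3 k4 DD DT.
- case: ab0 => /eqP; rewrite normr_eq0 => /eqP a0 [/eqP];
    rewrite normr_eq0 => /eqP d0 [b1 g1].
  exists b, g; split; [exact: norm_sq|exact: norm_sq|].
  by right; rewrite pE qE a0 d0 !scale0r add0r addr0.
- case: b0 => /eqP; rewrite normr_eq0 => /eqP b0 [/eqP];
    rewrite normr_eq0 => /eqP g0 [a1 d1].
  exists a, d; split; [exact: norm_sq|exact: norm_sq|].
  by left; rewrite pE qE b0 g0 !scale0r add0r addr0.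
Qed.
End Vertices.

(** * The John ellipse *)

Section John.
Variable R : realType.
Implicit Types (x y z c d e o p q : plane R) (K : set (plane R)).

Lemma ellipsoid_sub_rot c p q (a b g h : R) :
  a ^+ 2 + b ^+ 2 = 1 -> g ^+ 2 + h ^+ 2 = 1 -> a * g + b * h = 0 ->
  ellipsoid c p q `<=` ellipsoid c (a *: p + g *: q) (b *: p + h *: q).
Proof.
move=> ab gh o _ [[s t] /= st <-].
exists (a * s + g * t, b * s + h * t) => /=.
  rewrite (_ : _ + _ = (a ^+ 2 + b ^+ 2) * s ^+ 2 + (g ^+ 2 + h ^+ 2) * t ^+ 2 +
    2 * (a * g + b * h) * s * t); last by ring.
  by rewrite ab gh o mulr0 !mul0r !mul1r addr0.
rewrite -!addrA; congr (_ + _).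
transitivity (((a ^+ 2 + b ^+ 2) * s + (a * g + b * h) * t) *: p +
  ((g ^+ 2 + h ^+ 2) * t + (a * g + b * h) * s) *: q).
  by apply: plane_eq; rewrite /= !scalerE; ring.
by rewrite ab gh o !mul0r !mul1r !addr0.
Qed.

(** Orthonormal rows give orthonormal columns: the determinant [D] has square 1, and the matrix is
    [D] times its cofactor matrix. *)
Lemma orthogonal_transpose (a b g h : R) :
  a ^+ 2 + b ^+ 2 = 1 -> g ^+ 2 + h ^+ 2 = 1 -> a * g + b * h = 0 ->
  [/\ a ^+ 2 + g ^+ 2 = 1, b ^+ 2 + h ^+ 2 = 1 & a * b + g * h = 0].
Proof.
move=> ab gh o; set D := a * h - b * g.
have D1 : D ^+ 2 = 1.
  transitivity ((a ^+ 2 + b ^+ 2) * (g ^+ 2 + h ^+ 2) - (a * g + b * h) ^+ 2).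
    by rewrite /D; ring.
  by rewrite ab gh o; ring.
have aE : a = D * h.
  transitivity (a * (g ^+ 2 + h ^+ 2)); first by rewrite gh mulr1.
  transitivity (D * h + g * (a * g + b * h)); first by rewrite /D; ring.
  by rewrite o mulr0 addr0.
have bE : b = - (D * g).
  transitivity (b * (g ^+ 2 + h ^+ 2)); first by rewrite gh mulr1.
  transitivity (- (D * g) + h * (a * g + b * h)); first by rewrite /D; ring.
  by rewrite o mulr0 addr0.
clearbody D; split; rewrite ?aE ?bE.
- by rewrite exprMn D1 mul1r addrC.
- by rewrite sqrrN exprMn D1 mul1r.
- by transitivity ((1 - D ^+ 2) * (g * h)); [ring|rewrite D1 subrr mul0r].
Qed.

Lemma ellipsoid_rot c p q (a b g h : R) :
  a ^+ 2 + b ^+ 2 = 1 -> g ^+ 2 + h ^+ 2 = 1 -> a * g + b * h = 0 ->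
  ellipsoid c (a *: p + g *: q) (b *: p + h *: q) = ellipsoid c p q.
Proof.
move=> ab gh o; apply/seteqP; split; last exact: ellipsoid_sub_rot.
have [ag bh o'] := orthogonal_transpose ab gh o.
rewrite [X in _ `<=` ellipsoid _ X _](_ : p =
  a *: (a *: p + g *: q) + b *: (b *: p + h *: q)).
  rewrite [X in _ `<=` ellipsoid _ _ X](_ : q =
    g *: (a *: p + g *: q) + h *: (b *: p + h *: q)).
    exact: ellipsoid_sub_rot.
  transitivity ((a * g + b * h) *: p + (g ^+ 2 + h ^+ 2) *: q).
    by rewrite o gh scale0r scale1r add0r.
  by apply: plane_eq; rewrite /= !scalerE; ring.
transitivity ((a ^+ 2 + b ^+ 2) *: p + (a * g + b * h) *: q).
  by rewrite o ab scale0r scale1r addr0.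
by apply: plane_eq; rewrite /= !scalerE; ring.
Qed.

Lemma ellipsoid_sub_box c p q : ellipsoid c p q `<=` box c p q.
Proof.
move=> _ [[s t] /= st <-]; exists s; last exists t => //.
  by rewrite /= ler_norml; nra.
by rewrite /= ler_norml; nra.
Qed.

(** The form (a, b) is maximal on the disc at its own normalized coefficient vector; that point and
    its antipode cover both signs of [u]. *)
Lemma disc_support (u a b M : R) :
  (forall s t : R, s ^+ 2 + t ^+ 2 <= 1 -> `|u + s * a + t * b| <= M) ->
  `|u| + Num.sqrt (a ^+ 2 + b ^+ 2) <= M.
Proof.
move=> H; set n := Num.sqrt _.
have n2 : n ^+ 2 = a ^+ 2 + b ^+ 2 by rewrite sqr_sqrtr// addr_ge0 ?sqr_ge0.
have [n0|n0] := eqVneq n 0.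
  by have := H 0 0; rewrite n0 expr0n /= addr0 ler01 !mul0r !addr0; exact.
have np : 0 < n by rewrite lt0r n0 sqrtr_ge0.
have st : (a / n) ^+ 2 + (b / n) ^+ 2 <= 1.
  by rewrite !expr_div_n -mulrDl -n2 divff// expf_neq0.
have := H _ _ st; have st' : (- (a / n)) ^+ 2 + (- (b / n)) ^+ 2 <= 1 by rewrite
  !sqrrN.
have := H _ _ st'.
have E : a / n * a + b / n * b = n.
  by apply: (mulIf n0); rewrite -expr2 n2; field.
have -> : u + - (a / n) * a + - (b / n) * b = u - n.
  by rewrite -[in RHS]E; ring.
have -> : u + a / n * a + b / n * b = u + n.
  by rewrite -[in RHS]E; ring.
by rewrite !ler_norml; case: (ger0P u); lra.
Qed.

(* In the basis (p, q) the rows of the matrix of (x, y) have norm at most 1 by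
   the support condition, so Hadamard's inequality bounds the determinant. *)
Lemma ellipsoid_in_box c p q c' x y : det p q != 0 ->
  ellipsoid c' x y `<=` box c p q ->
  `|det x y| < `|det p q| \/ ellipsoid c' x y = ellipsoid c p q.
Proof.
move=> D0 sub.
have D1 : 0 < `|det p q| by rewrite normr_gt0.
have xE := det_decomp x D0; have yE := det_decomp y D0.
have cE := det_decomp (c' - c) D0.
set a := det x q / _ in xE; set g := det p x / _ in xE.
set b := det y q / _ in yE; set h := det p y / _ in yE.
set u := det (c' - c) q / _ in cE; set v := det p (c' - c) / _ in cE.
have mem s t : s ^+ 2 + t ^+ 2 <= 1 ->
  `|u + s * a + t * b| <= 1 /\ `|v + s * g + t * h| <= 1.
  move=> st; have : ellipsoid c' x y (c' + s *: x + t *: y) by exists (s, t).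
  move=> /sub /(mem_box c _ D0).
  have -> : c' + s *: x + t *: y - c = (u + s * a + t * b) *: p + (v + s * g + t
    * h) *: q.
    transitivity ((c' - c) + s *: x + t *: y); first by apply: plane_eq;
      rewrite /=; ring.
    rewrite cE xE yE.
    by apply: plane_eq; rewrite /= !scalerE; ring.
  move: (u + _ + _) (v + _ + _) => U V.
  have -> : det (U *: p + V *: q) q = U * det p q by rewrite /det /= !scalerE;
    ring.
  have -> : det p (U *: p + V *: q) = V * det p q by rewrite /det /= !scalerE;
    ring.
  by rewrite !normrM !ger_pMl.
have := disc_support (fun s t st => (mem s t st).1).
have := disc_support (fun s t st => (mem s t st).2).
set n2 := Num.sqrt _; set n1 := Num.sqrt _ => v2 u1.
have n1E : n1 ^+ 2 = a ^+ 2 + b ^+ 2 by rewrite sqr_sqrtr// addr_ge0 ?sqr_ge0.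
have n2E : n2 ^+ 2 = g ^+ 2 + h ^+ 2 by rewrite sqr_sqrtr// addr_ge0 ?sqr_ge0.
have n10 : 0 <= n1 by exact: sqrtr_ge0.
have n20 : 0 <= n2 by exact: sqrtr_ge0.
have DE : det x y = (a * h - b * g) * det p q by rewrite xE yE /det /= !scalerE;
  ring.
have [|Dge] := ltP `|det x y| `|det p q|; [by left|right].
have {}Dge : 1 <= (a * h - b * g) ^+ 2.
  rewrite -[leRHS]real_normK ?num_real// -[leLHS](expr1n _ 2) ler_pXn2r
    ?nnegrE//.
  by move: Dge; rewrite DE normrM ler_pMl.
(* Lagrange's identity for the rows (a, b) and (g, h). With row lengths at most 1 and determinant at
   least 1 in absolute value, equality holds throughout: the rows are orthonormal and the offsets
   [u], [v] vanish. *)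
have lag : (a * h - b * g) ^+ 2 + (a * g + b * h) ^+ 2 = n1 ^+ 2 * n2 ^+ 2.
  by rewrite n1E n2E; ring.
have u0 := normr_ge0 u; have v0 := normr_ge0 v.
have n1le : n1 <= 1 by lra.
have n2le : n2 <= 1 by lra.
have s1 : n1 ^+ 2 <= 1 by rewrite expr_le1.
have s2 : n2 ^+ 2 <= 1 by rewrite expr_le1.
have o2 := sqr_ge0 (a * g + b * h).
have P1 : 1 <= n1 ^+ 2 * n2 ^+ 2 by lra.
have n11 : n1 ^+ 2 = 1 by have := sqr_ge0 n1; nra.
have n21 : n2 ^+ 2 = 1 by have := sqr_ge0 n2; nra.
have o : a * g + b * h = 0 by apply/eqP; rewrite -sqrf_eq0; apply/eqP;
  rewrite n11 n21 in lag; lra.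
have n1e : n1 = 1 by nra.
have n2e : n2 = 1 by nra.
have u00 : u = 0 by apply/eqP; rewrite -normr_eq0; apply/eqP; lra.
have v00 : v = 0 by apply/eqP; rewrite -normr_eq0; apply/eqP; lra.
have -> : c' = c by apply/eqP; rewrite -subr_eq0 cE u00 v00 !scale0r addr0.
by rewrite xE yE; apply: ellipsoid_rot; rewrite -?n1E -?n2E.
Qed.

Lemma ellipse_ellipsoid E : ellipse E ->
  exists c x y, det x y != 0 /\ E = ellipsoid c x y.
Proof.
move=> [c [u [v [a [b [uu vv uv [a0 b0] ->]]]]]].
exists c, (a *: u), (b *: v); split; last first.
  rewrite /ellipsoid; apply: eq_imagel => -[s t] _ /=.
  by rewrite !scalerA.
have : det u v ^+ 2 = 1.
  transitivity (dot u u * dot v v - dot u v ^+ 2); first by rewrite /det /dot;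
    ring.
  by rewrite uu vv uv; ring.
have -> : det (a *: u) (b *: v) = a * b * det u v by rewrite /det /= !scalerE;
  ring.
move=> D1; apply: mulf_neq0; first by rewrite mulf_neq0// gt_eqF.
by rewrite -sqrf_eq0 D1 oner_eq0.
Qed.

Lemma ellipsoid_ellipse c x y : x != 0 -> y != 0 -> dot x y = 0 ->
  ellipse_with c ((enorm x)^-1 *: x) ((enorm y)^-1 *: y) (enorm x) (enorm y)
    (ellipsoid c x y).
Proof.
move=> x0 y0 xy.
have nx : 0 < enorm x by rewrite /enorm sqrtr_gt0 dot_gt0.
have ny : 0 < enorm y by rewrite /enorm sqrtr_gt0 dot_gt0.
have nu z : 0 < enorm z -> dot ((enorm z)^-1 *: z) ((enorm z)^-1 *: z) = 1.
  move=> nz; transitivity ((enorm z ^+ 2)^-1 * dot z z).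
    by rewrite /dot /= !scalerE; field; rewrite gt_eqF.
  rewrite sqr_sqrtr ?mulVf// ?sqrf_eq0; first by rewrite gt_eqF// -sqrtr_gt0.
  by rewrite ltW// -sqrtr_gt0.
split; [exact: nu|exact: nu| |by split|].
  transitivity ((enorm x)^-1 * (enorm y)^-1 * dot x y);
    last by rewrite xy mulr0.
  by rewrite /dot /= !scalerE; ring.
rewrite /ellipsoid; apply: eq_imagel => -[s t] _ /=.
by rewrite !scalerA !mulfK ?gt_eqF.
Qed.

(** That the inscribed set has orthonormal axes is a hypothesis here; [john_axis_box] discharges it
    with the axes it constructs. *)
Lemma john_ellipsoid c p q : det p q != 0 -> ellipse (ellipsoid c p q) ->
  john_ellipse (box c p q) (ellipsoid c p q).
Proof.
move=> D0 eE; split => //; first exact: ellipsoid_sub_box.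
move=> _ /ellipse_ellipsoid[c' [x [y [D0' ->]]]] sub neq.
have [lt|//] := ellipsoid_in_box D0 sub.
rewrite !area_ellipsoid//.
rewrite lte_pmul2r ?half_disc_area_fin ?half_disc_area_gt0//.
by rewrite lte_fin ltr_pM2l.
Qed.

End John.

(** * Bisectors and principal axes *)

Section Bisectors.
Variable R : realType.
Implicit Types (x y z c d e o p q : plane R) (K : set (plane R)).

Definition cosine x y : R := dot x y / (enorm x * enorm y).

Lemma angleE x y z : angle (y + x) y (y + z) = acos (cosine x z).
Proof. by rewrite /angle (addrC y x) (addrC y z) !addrK. Qed.

Lemma dotC x y : dot x y = dot y x.
Proof. by rewrite /dot; ring. Qed.

Lemma cosineC x y : cosine x y = cosine y x.
Proof. by rewrite /cosine dotC (mulrC (enorm x)). Qed.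

Lemma dot_ge0 x : 0 <= dot x x.
Proof. by rewrite /dot addr_ge0// -expr2 sqr_ge0. Qed.

Lemma enorm_sqr x : enorm x ^+ 2 = dot x x.
Proof. by rewrite sqr_sqrtr// dot_ge0. Qed.

Lemma enorm_gt0 x : x != 0 -> 0 < enorm x.
Proof. by move=> x0; rewrite sqrtr_gt0 dot_gt0. Qed.

Lemma enormZ (a : R) x : enorm (a *: x) = `|a| * enorm x.
Proof.
rewrite /enorm (_ : dot _ _ = a ^+ 2 * dot x x);
  last by rewrite /dot /= !scalerE; ring.
by rewrite sqrtrM ?sqr_ge0// sqrtr_sqr.
Qed.

Lemma cosineZ (a : R) x y : 0 < a -> cosine x (a *: y) = cosine x y.
Proof.
move=> a0; rewrite /cosine enormZ gtr0_norm// (_ : dot _ _ = a * dot x y);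
  last first.
  by rewrite /dot /= !scalerE; ring.
by rewrite mulrCA invfM mulrACA divff ?mul1r// gt_eqF.
Qed.

Lemma cosine_itv x y : -1 <= cosine x y <= 1.
Proof.
rewrite -ler_norml /cosine normrM normfV (ger0_norm (_ : 0 <= enorm x * enorm
  y)); last first.
  by rewrite mulr_ge0// sqrtr_ge0.
have [E|E] := eqVneq (enorm x * enorm y) 0; first by rewrite E invr0 mulr0.
have E0 : 0 < enorm x * enorm y by rewrite lt0r E mulr_ge0// sqrtr_ge0.
rewrite ler_pdivrMr// mul1r -(@ler_pXn2r _ 2)// ?nnegrE ?normr_ge0 ?(ltW E0)//.
rewrite exprMn !enorm_sqr real_normK ?num_real// -subr_ge0.
rewrite (_ : _ - _ = det x y ^+ 2) ?sqr_ge0//.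
by rewrite /det /dot; ring.
Qed.

Lemma acos_half (c : R) : -1 <= c <= 1 ->
  acos (Num.sqrt ((1 + c) / 2)) = acos c / 2.
Proof.
move=> c1; have a0 := acos_ge0 c1; have api := acos_lepi c1.
have pi0 := pi_ge0 R.
have ch : 0 <= cos (acos c / 2).
  by apply: cos_ge0_pihalf; apply/andP; split; lra.
rewrite (_ : (1 + c) / 2 = cos (acos c / 2) ^+ 2).
  by rewrite sqrtr_sqr ger0_norm// cosK// in_itv/=; apply/andP; split; lra.
have := cosD (acos c / 2) (acos c / 2); rewrite -splitr acosK ?in_itv//.
have := cos2Dsin2 (acos c / 2); lra.
Qed.

(** The sum is the diagonal of a rhombus. Its cosine with [x] is nonnegative, so comparing squares
    with the half-angle formula is enough. *)
Lemma half_angle x y : dot x x = dot y y -> x + y != 0 ->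
  acos (cosine x (x + y)) = acos (cosine x y) / 2.
Proof.
move=> xy s0; rewrite -acos_half ?cosine_itv//; congr acos.
have s1 := dot_gt0 s0.
have sE : dot (x + y) (x + y) = 2 * (dot x x + dot x y).
  by rewrite [dot x x]splitr {2}xy /dot /=; field.
have D : 0 < dot x x + dot x y by move: s1; rewrite sE; lra.
have x0 : 0 < dot x x.
  rewrite lt0r dot_ge0 andbT; apply: contra s0 => /eqP dx.
  have z0 z : dot z z = 0 -> z = 0.
    by move=> dz; apply/eqP/negPn/negP => /dot_gt0; rewrite dz ltxx.
  by rewrite (z0 x)// (z0 y) ?addr0// -xy.
have nx : 0 < enorm x by rewrite sqrtr_gt0.
have ns : 0 < enorm (x + y) by rewrite sqrtr_gt0.
have ny : enorm y = enorm x by rewrite /enorm xy.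
have c0 : 0 <= cosine x (x + y).
  rewrite /cosine divr_ge0 ?mulr_ge0 ?ltW//.
  by rewrite (_ : dot _ _ = dot x x + dot x y)// /dot /=; ring.
rewrite -[LHS]ger0_norm// -sqrtr_sqr; congr Num.sqrt.
rewrite /cosine ny expr_div_n exprMn !enorm_sqr -expr2 enorm_sqr sE.
rewrite (_ : dot x (x + y) = dot x x + dot x y); last by rewrite /dot /=; ring.
by field; rewrite !gt_eqF.
Qed.

Lemma dot_refl e x y : dot (refl e x) (refl e y) = dot e e * dot x y.
Proof. by rewrite /dot /=; ring. Qed.

Lemma add_refl d x : d != 0 ->
  x + refl (double_dir d) x = (2 * dot x d / dot d d) *: d.
Proof.
move=> /dot_gt0 d0; apply: plane_eq; move: d0.
  by rewrite /double_dir /refl /dot /= !scalerE => d0; field; rewrite gt_eqF.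
by rewrite /double_dir /refl /dot /= !scalerE => d0; field; rewrite gt_eqF.
Qed.

(** A vector and its mirror image have equal length and add up to a multiple of [d], so [half_angle]
    applies from both sides. The sign of [mu] picks the ray through [z] rather than the opposite
    one. *)
Lemma bisector_refl d y x z (mu : R) : d != 0 -> 0 < mu -> det x z != 0 ->
  refl (double_dir d) x = mu *: z -> bisector (y + x) y (y + z) (line y d).
Proof.
move=> d0 mu0 D0 xz.
have s0 : x + mu *: z != 0.
  apply: contra D0; rewrite addr_eq0 => /eqP ->; apply/eqP.
  by rewrite /det /= !scalerE; ring.
have xx : dot x x = dot (mu *: z) (mu *: z).
  by rewrite -xz dot_refl dot_double_dir// mul1r.
split; first by exists y, d.
  by exists 0 => //; rewrite scale0r addr0.
exists (y + (x + mu *: z)); split.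
- by rewrite -xz add_refl//; exists (2 * dot x d / dot d d).
- by rewrite -subr_eq0 addrC addKr.
- by rewrite !angleE half_angle// cosineZ.
- rewrite !angleE -(cosineZ (x + mu *: z) z mu0) cosineC [x + _]addrC
    half_angle//.
    by rewrite cosineC cosineZ.
  by rewrite addrC.
Qed.

Lemma line_parallel o y d : parallel (line o d) (line y d).
Proof.
exists (y - o); apply/seteqP; split => x.
  move=> [t _ <-]; exists (o + t *: d); first by exists t.
  by rewrite addrA subrK.
by move=> [_ [t _ <-] <-]; exists t => //; rewrite addrA subrK.
Qed.

Lemma edge_bisector_box c p q d : det p q != 0 -> d != 0 ->
  mxm p q (double_dir d) = 0 -> exists y, edge_bisector (box c p q) (line y d).
Proof.
(* With m = 0 the reflection sends [q] to k times [p]. If k is negative, replacing [p] by [- p]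
   keeps the box, moves to an adjacent vertex and corrects the sign. *)
wlog k0 : p / 0 < mxk p q (double_dir d) => [wlg|] D0 d0 m0.
  have := mx_det D0 (dot_double_dir d0); rewrite m0 expr0n /= add0r => kl.
  have [k0|k0|k0] := ltgtP 0 (mxk p q (double_dir d)).
  - exact: wlg.
  - have DN : det (- p) q = - det p q by rewrite /det /=; ring.
    rewrite -box_opp; apply: wlg => //.
    + by rewrite /mxk DN invrN mulrN oppr_gt0.
    + by rewrite DN oppr_eq0.
    + rewrite /mxm DN (_ : det _ _ = - det (refl (double_dir d) p) q);
      last by rewrite /det /=; ring.
      by rewrite invrN mulrNN.
  - by move: kl; rewrite -k0 mul0r => /esym/eqP; rewrite oner_eq0.
exists (c - p - q); exists (c - p - q), (c + p - q), (c + p + q), (c - p + q).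
split; first exact: vertices_box.
have := @bisector_refl d (c - p - q) (2 *: q) (2 *: p) (mxk p q (double_dir d)).
have -> : c - p - q + 2 *: q = c - p + q by apply: plane_eq;
  rewrite /= !scalerE; ring.
have -> : c - p - q + 2 *: p = c + p - q by apply: plane_eq;
  rewrite /= !scalerE; ring.
apply => //.
  by rewrite (_ : det _ _ = - 4 * det p q) ?mulf_neq0//;
    rewrite /det /= !scalerE; ring.
by rewrite reflZ (refl_basisr _ D0) m0 scale0r subr0 !scalerA mulrC.
Qed.

Lemma diagonal_bisector_box c p q d : det p q != 0 -> d != 0 ->
  mxk p q (double_dir d) = - mxl p q (double_dir d) ->
  exists y, diagonal_bisector (box c p q) (line y d).
Proof.
move=> D0 d0 kl; set e := double_dir d in kl *.
have := mx_det D0 (dot_double_dir d0); rewrite -/e kl mulNr -expr2 => ml.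
have D4 x y : det (x + y) (x - y) = - 2 * det x y by rewrite /det /=; ring.
have := refl_basisl e D0; have := refl_basisr e D0; rewrite kl.
set m := mxm _ _ _ in ml *; set l := mxl _ _ _ in kl ml * => rq rp.
have rpq : refl e (p + q) = (m - l) *: (p - q).
  by rewrite reflD rp rq; apply: plane_eq; rewrite /= !scalerE; ring.
(* The sign decides which of the two supplementary angles between the diagonals is bisected;
   exchanging [p] and [q] in the listing gives the other one. Zero is excluded by (m - l)(m + l) =
   1. *)
have [s0|s0|s0] := ltgtP (m - l) 0.
- exists c, (c - p - q), (c + p - q), (c + p + q), (c - p + q).
  split; first exact: vertices_box.
  have -> : midpoint (c - p - q) (c + p + q) = c.
    by apply: plane_eq; rewrite /= !scalerE; field.
  have := @bisector_refl d c (- (p + q)) (p - q) (l - m) d0.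
  rewrite !addrA opprD addrA; apply.
  + by rewrite -opprB oppr_gt0.
  + by rewrite (_ : det _ _ = 2 * det p q) ?mulf_neq0//; rewrite /det /=; ring.
  + rewrite -opprD -scaleN1r reflZ -/e rpq scalerA; congr (_ *: _); ring.
- exists c, (c - q - p), (c + q - p), (c + q + p), (c - q + p).
  split.
    by rewrite -box_swap; apply: vertices_box; rewrite det_swap oppr_eq0.
  have -> : midpoint (c - q - p) (c + q + p) = c.
    by apply: plane_eq; rewrite /= !scalerE; field.
  have := @bisector_refl d c (- (q + p)) (q - p) (m - l) d0.
  rewrite !addrA opprD addrA; apply => //.
  + by rewrite (_ : det _ _ = - 2 * det p q) ?mulf_neq0//; rewrite /det /=;
    ring.
  + by rewrite -opprD addrC -scaleN1r reflZ -/e rpq scalerA mulN1r scaleNr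
    -scalerN opprB.
- move: ml; rewrite (_ : m ^+ 2 + _ = (m - l) * (m + l)); last by ring.
  by rewrite s0 mul0r => /esym/eqP; rewrite oner_eq0.
Qed.

Lemma refl_fixed d x : d != 0 -> refl (double_dir d) x = x ->
  x = (dot x d / dot d d) *: d.
Proof.
move=> d0 xx; have := add_refl x d0; rewrite xx => H.
transitivity ((2^-1 : R) *: (x + x)).
  by apply: plane_eq; rewrite /= !scalerE; field.
by rewrite H scalerA; congr (_ *: _); field; rewrite gt_eqF// dot_gt0.
Qed.

Lemma john_axis_box c p q d : det p q != 0 -> d != 0 ->
  mxk p q (double_dir d) = mxl p q (double_dir d) ->
  john_ellipse (box c p q) (ellipsoid c p q) /\
  principal_axis (ellipsoid c p q) (line c d).
Proof.
move=> D0 d0 kl; set e := double_dir d in kl *.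
have e1 : dot e e = 1 by exact: dot_double_dir.
have := mx_det D0 e1; rewrite kl -expr2 => ml.
have := refl_basisl e D0; have := refl_basisr e D0; rewrite kl.
set m := mxm _ _ _ in ml *; set l := mxl _ _ _ in kl ml * => rq rp.
(* In coordinates with respect to [p] and [q] the matrix [[m, l], [l, -m]] is itself a Euclidean
   reflection; [h] spans its mirror line. *)
have [h h0 hE] : exists2 h : plane R, h != 0 & double_dir h = (m, l).
  by apply: double_dir_surj; rewrite /dot /= -!expr2.
have hh := dot_gt0 h0.
have [h1 h2] : m * h.1 + l * h.2 = h.1 /\ l * h.1 - m * h.2 = h.2.
  move: (congr1 fst hE) (congr1 snd hE); rewrite /= => <- <-.
  by move: hh; rewrite /dot => hh; split; field; rewrite gt_eqF.
pose n := enorm h; have n0 : 0 < n by exact: enorm_gt0.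
have n2 : n ^+ 2 = h.1 ^+ 2 + h.2 ^+ 2 by rewrite /n enorm_sqr /dot !expr2.
pose a := h.1 / n; pose b := h.2 / n.
have ab : a ^+ 2 + b ^+ 2 = 1.
  by rewrite !expr_div_n -mulrDl -n2 divff// expf_neq0// gt_eqF.
have ma : m * a + l * b = a by rewrite /a /b -[in RHS]h1; ring.
have mb : l * a - m * b = b by rewrite /a /b -[in RHS]h2; ring.
pose P := a *: p + b *: q; pose Q := - b *: p + a *: q.
have PE : refl e P = P.
  transitivity ((m * a + l * b) *: p + (l * a - m * b) *: q);
    last by rewrite ma mb.
  rewrite /P reflD !reflZ rp rq.
  by apply: plane_eq; rewrite /= !scalerE; ring.
have QE : refl e Q = - Q.
  transitivity ((l * a - m * b) *: p - (m * a + l * b) *: q).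
    rewrite /Q reflD !reflZ rp rq.
    by apply: plane_eq; rewrite /= !scalerE; ring.
  by rewrite ma mb /Q; apply: plane_eq; rewrite /= !scalerE; ring.
have DPQ : det P Q = det p q.
  rewrite -[RHS]mul1r -ab /P /Q /det /= !scalerE; ring.
have nz x y : det x y != 0 -> x != 0 /\ y != 0.
  by move=> H; split; apply: contra H => /eqP ->; apply/eqP; rewrite /det /=;
    ring.
have [P0 Q0] : P != 0 /\ Q != 0 by apply: nz; rewrite DPQ.
(* An orthogonal map that fixes [P] and negates [Q] makes them orthogonal, so these conjugate
   half-diameters are the semi-axes. *)
have PQ : dot P Q = 0.
  have : dot P Q = - dot P Q.
    by rewrite -[LHS]mul1r -e1 -dot_refl PE QE /dot /=; ring.
  lra.
have EE : ellipsoid c p q = ellipsoid c P Q.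
  rewrite [RHS]ellipsoid_rot ?sqrrN//; first by rewrite addrC.
  by ring.
have ax := ellipsoid_ellipse c P0 Q0 PQ; rewrite -EE in ax.
split.
  by apply: john_ellipsoid => //; do 5!eexists; exact: ax.
do 5!eexists; split; first exact: ax.
have := refl_fixed d0 PE; set r := _ / _ => Pd.
have r0 : r != 0 by apply: contra P0 => /eqP r0; rewrite Pd r0 scale0r.
have nP := enorm_gt0 P0.
apply/seteqP; split => x [t _ <-].
  exists (t * enorm P / r) => //; rewrite {3}Pd !scalerA; congr (_ + _ *: _).
  by field; rewrite r0 gt_eqF.
by exists (t * (enorm P)^-1 * r) => //; rewrite {3}Pd !scalerA.
Qed.

End Bisectors.

(** * The values of the chirality *)

Section Values.
Variable R : realType.
Implicit Types (x y z c d e o p q : plane R) (K : set (plane R)).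

Lemma unit_kernel (a b : R) : exists2 e : plane R,
  dot e e = 1 & a * e.1 + b * e.2 = 0.
Proof.
have [ab|ab] := eqVneq ((- b, a) : plane R) 0.
  case: ab => /eqP; rewrite oppr_eq0 => /eqP -> ->.
  by exists (1, 0); rewrite /dot /=; ring.
have n0 := enorm_gt0 ab.
exists ((enorm (- b, a))^-1 *: (- b, a)).
  transitivity ((enorm (- b, a) ^+ 2)^-1 * dot ((- b, a) : plane R) (- b, a)).
    by rewrite /dot /= !scalerE; field; rewrite gt_eqF.
  by rewrite enorm_sqr mulVf// gt_eqF// dot_gt0.
by rewrite /= !scalerE; ring.
Qed.

Lemma mxm_kernel p q : exists2 e, dot e e = 1 & mxm p q e = 0.
Proof.
have [e e1 e0] := unit_kernel (mxm p q (1, 0)) (mxm p q (0, 1)).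
by exists e => //; rewrite -[RHS]e0 /mxm /det /=; ring.
Qed.

Lemma mxkl_kernel p q (s : R) : exists2 e,
  dot e e = 1 & mxk p q e = s * mxl p q e.
Proof.
have [e e1 e0] := unit_kernel (mxk p q (1, 0) - s * mxl p q (1, 0))
  (mxk p q (0, 1) - s * mxl p q (0, 1)).
by exists e => //; apply/eqP; rewrite -subr_eq0 -[X in _ == X]e0; apply/eqP;
  rewrite /mxk /mxl /det /=; ring.
Qed.

Lemma det_neq0 p q : det p q != 0 -> p != 0 /\ q != 0.
Proof.
by move=> H; split; apply: contra H => /eqP ->; apply/eqP; rewrite /det /=;
  ring.
Qed.

Lemma alpha1_le c p q e : det p q != 0 -> dot e e = 1 ->
  alpha1 (box c p q) <= mxnorm p q e.
Proof. by move=> D0 e1; have [e' [_ -> H]] := alpha1_box c D0; exact: H. Qed.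

Lemma alpha1_attained c p q : det p q != 0 -> exists e,
  [/\ dot e e = 1, alpha1 (box c p q) = mxnorm p q e &
    [\/ mxm p q e = 0, mxk p q e = mxl p q e | mxk p q e = - mxl p q e]].
Proof.
move=> D0; have [e [e1 eE emin]] := alpha1_box c D0.
by exists e; split => //; exact: mxnorm_minimizer.
Qed.

Lemma sqrt_le_of_sqr (a b : R) : 0 <= b -> a <= b ^+ 2 -> Num.sqrt a <= b.
Proof. by move=> b0 ab; rewrite -[leRHS]ger0_norm// -sqrtr_sqr ler_wsqrtr. Qed.

Lemma le_sqrt_of_sqr (a b : R) : b ^+ 2 <= a -> b <= Num.sqrt a.
Proof. by move=> ba; rewrite (le_trans (ler_norm _))// -sqrtr_sqr ler_wsqrtr.
  Qed.

Lemma sqr_norm (a : R) : `|a| ^+ 2 = a ^+ 2.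
Proof. by rewrite real_normK ?num_real. Qed.

Lemma alpha1_ge1 c p q : det p q != 0 -> 1 <= alpha1 (box c p q).
Proof.
by move=> D0; have [e [e1 -> _]] := alpha1_attained c D0; exact: mxnorm_ge1.
Qed.

Lemma alpha1_le_sqrt2 c p q : det p q != 0 -> alpha1 (box c p q) <= Num.sqrt 2.
Proof.
move=> D0; have [e e1] := mxkl_kernel p q 1; rewrite mul1r => kl.
apply: le_trans (alpha1_le c D0 e1) _; apply: le_sqrt_of_sqr.
rewrite /mxnorm kl maxxx; have := mx_det D0 e1; rewrite kl -expr2.
rewrite -(sqr_norm (mxm _ _ _)) -(sqr_norm (mxl _ _ _)).
move: `|_| `|_| => u v uv; have := sqr_ge0 (u - v); lra.
Qed.

(** At this corner |k| and |l| are the ratio of the edge lengths and its inverse. *)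
Lemma mxm0_sqr p q e : det p q != 0 -> dot e e = 1 -> mxm p q e = 0 ->
  dot p p * mxk p q e ^+ 2 = dot q q /\ dot q q * mxl p q e ^+ 2 = dot p p.
Proof.
move=> D0 e1 m0; have := mx_det D0 e1; have := mx_sym e D0.
rewrite m0 expr0n /= add0r mulr0; move: (mxk p q e) (mxl p q e) => k l /eqP.
rewrite subr_eq0 => /eqP AB kl; split.
  by rewrite expr2 mulrA AB -mulrA (mulrC l) kl mulr1.
by rewrite expr2 mulrA -AB -mulrA kl mulr1.
Qed.

(** For value 1, the corner m = 0 forces equal edges; the corner k = l forces m l = 0, a rhombus if
    m = 0 and a rectangle if l = 0; the corner k = -l forces l = 0, a rectangle. Conversely,
    rectangles reach 1 at k = -l and rhombuses at m = 0. *)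
Lemma alpha1_eq1 c p q : det p q != 0 ->
  alpha1 (box c p q) = 1 <-> dot p q = 0 \/ dot p p = dot q q.
Proof.
move=> D0; have [p0 q0] := det_neq0 D0.
have A0 := dot_gt0 p0; have B0 := dot_gt0 q0; split.
  have [e [e1 -> cas]] := alpha1_attained c D0.
  have := mx_det D0 e1; have := mx_sym e D0; case: cas => [m0|kl|kl].
  - rewrite /mxnorm m0 normr0 add0r expr0n /= mulr0 add0r.
    have [kE lE] := mxm0_sqr D0 e1 m0 => _ _ N1; right.
    have k1 : mxk p q e ^+ 2 <= 1 by rewrite -sqr_norm expr_le1// -N1 le_max
      lexx.
    have l1 : mxl p q e ^+ 2 <= 1 by rewrite -sqr_norm expr_le1// -N1 le_max
      lexx orbT.
    apply/eqP; rewrite eq_le; apply/andP; split.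
      by rewrite -lE ger_pMr.
    by rewrite -kE ger_pMr.
  - rewrite /mxnorm kl maxxx -expr2;
      move: (mxm p q e) (mxl p q e) => m l E1 E2 N1.
    have : `|m| * `|l| = 0.
      move: E2; rewrite -(sqr_norm m) -(sqr_norm l).
      have : (`|m| + `|l|) ^+ 2 = 1 by rewrite N1 expr1n.
      by move: `|m| `|l| => u v; lra.
    move=> /eqP; rewrite mulf_eq0 !normr_eq0 => /orP[]/eqP z0; move: E1 E2;
      rewrite z0.
      rewrite mulr0 expr0n /= add0r => E1 l1; right.
      have l0 : l != 0 by apply/eqP => l0; move: l1; rewrite l0 expr0n /=; lra.
      by apply: (mulIf l0); lra.
    rewrite expr0n /= addr0 => E1 m1; left.
    have m0 : m != 0 by apply/eqP => m0; move: m1; rewrite m0 expr0n /=; lra.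
    by apply: (mulIf m0); lra.
  - rewrite /mxnorm kl normrN maxxx mulNr -expr2;
      move: (mxm p q e) (mxl p q e) => m l E1 E2 N1.
    have l0 : l = 0.
      apply/eqP; rewrite -normr_eq0; apply/eqP.
      move: E2; rewrite -(sqr_norm m) -(sqr_norm l) (_ : `|m| = 1 - `|l|);
        last by lra.
      by move: `|l| => v; lra.
    move: E1 E2; rewrite l0 expr0n /= subr0 => E1 m1; left.
    have m0 : m != 0 by apply/eqP => m0; move: m1; rewrite m0 expr0n /=; lra.
    by apply: (mulIf m0); lra.
move=> H; apply/eqP; rewrite eq_le alpha1_ge1// andbT.
case: H => [w0|AB].
  have [e e1] := mxkl_kernel p q (- 1); rewrite mulN1r => kl.
  apply: le_trans (alpha1_le c D0 e1) _; rewrite /mxnorm kl normrN maxxx.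
  have := mx_det D0 e1; have := mx_sym e D0; rewrite kl w0 mulr0 mul0r.
  move: (mxm p q e) (mxl p q e) => m l E1.
  have -> : l = 0.
    have AB0 : dot p p + dot q q != 0 by rewrite gt_eqF// addr_gt0.
    by apply: (mulIf AB0); lra.
  by rewrite mulr0 addr0 normr0 addr0 -sqr_norm => m1;
    rewrite -(@ler_pXn2r _ 2)// ?nnegrE// m1 expr1n.
have [e e1 m0] := mxm_kernel p q.
apply: le_trans (alpha1_le c D0 e1) _; rewrite /mxnorm m0 normr0 add0r.
have [] := mxm0_sqr D0 e1 m0; rewrite -AB.
move=> /(canRL (mulKf (lt0r_neq0 A0))); rewrite mulVf ?gt_eqF// => k1.
move=> /(canRL (mulKf (lt0r_neq0 A0))); rewrite mulVf ?gt_eqF// => l1.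
by rewrite ge_max -!(@ler_pXn2r _ 2 _ _ 1)// ?nnegrE// !sqr_norm k1 l1 expr1n
  lexx.
Qed.

Lemma max_ge_sqr (k l a : R) : a <= k ^+ 2 \/ a <= l ^+ 2 ->
  Num.sqrt a <= Num.max `|k| `|l|.
Proof.
by rewrite le_max => -[] h; apply/orP; [left|right]; apply: sqrt_le_of_sqr;
  rewrite ?sqr_norm.
Qed.

(** The corner k = l reaches its bound exactly when |m| = |l|, which [mx_sym] turns into the first
    condition; the second says that the value at m = 0, the larger edge ratio, is at least the
    square root of 2. *)
Lemma alpha1_eq_sqrt2 c p q : det p q != 0 ->
  alpha1 (box c p q) = Num.sqrt 2 <->
  `|dot p p - dot q q| = 2 * `|dot p q| /\
  (2 * dot p p <= dot q q \/ 2 * dot q q <= dot p p).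
Proof.
move=> D0; have [p0 q0] := det_neq0 D0.
have A0 := dot_gt0 p0; have B0 := dot_gt0 q0; split.
  move=> aE; split.
    have [e e1] := mxkl_kernel p q 1; rewrite mul1r => kl.
    have := alpha1_le c D0 e1; rewrite aE /mxnorm kl maxxx.
    have := mx_det D0 e1; have := mx_sym e D0; rewrite kl -expr2.
    move: (mxm p q e) (mxl p q e) => m l E1 E2 N2.
    have : 2 <= (`|m| + `|l|) ^+ 2.
      by rewrite -[leLHS](@sqr_sqrtr _ 2)// ler_pXn2r ?nnegrE ?sqrtr_ge0//
        addr_ge0.
    move: E2; rewrite -(sqr_norm m) -(sqr_norm l) => E2 {}N2.
    have ml : `|m| = `|l|.
      apply/eqP; rewrite -subr_eq0 -sqrf_eq0; apply/eqP.
      have := sqr_ge0 (`|m| - `|l|); move: N2 E2; move: `|m| `|l| => u v; lra.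
    have l0 : `|l| != 0 by apply/eqP => l0; move: E2; rewrite ml l0 expr0n /=;
      lra.
    apply: (mulIf l0); rewrite -{2}ml -[2 in RHS]ger0_norm// -!normrM.
    by congr (`|_|); lra.
  have [e e1 m0] := mxm_kernel p q.
  have := alpha1_le c D0 e1; rewrite aE /mxnorm m0 normr0 add0r.
  have [] := mxm0_sqr D0 e1 m0; move: (mxk p q e) (mxl p q e) => k l kE lE.
  rewrite le_max => /orP[] h; [left|right].
    rewrite -kE mulrC ler_pM2l// -sqr_norm -[leLHS](@sqr_sqrtr _ 2)//.
    by rewrite ler_pXn2r ?nnegrE ?sqrtr_ge0.
  rewrite -lE mulrC ler_pM2l// -sqr_norm -[leLHS](@sqr_sqrtr _ 2)//.
  by rewrite ler_pXn2r ?nnegrE ?sqrtr_ge0.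
move=> [wE AB]; apply/eqP; rewrite eq_le alpha1_le_sqrt2//=.
have [e [e1 -> cas]] := alpha1_attained c D0.
have := mx_det D0 e1; have := mx_sym e D0; case: cas => [m0|kl|kl].
- move=> _ _; rewrite /mxnorm m0 normr0 add0r; have [] := mxm0_sqr D0 e1 m0.
  move: (mxk p q e) (mxl p q e) => k l kE lE; apply: max_ge_sqr.
  case: AB => h; [left|right].
    by rewrite -(ler_pM2l A0) kE mulrC.
  by rewrite -(ler_pM2l B0) lE mulrC.
- rewrite /mxnorm kl maxxx -expr2; move: (mxm p q e) (mxl p q e) => m l E1 E2.
  have AB0 : `|dot p p - dot q q| != 0.
    by rewrite normr_eq0 subr_eq0; apply/eqP => ABe; move: AB; rewrite ABe; lra.
  have ml : `|l| = `|m|.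
    apply: (mulfI AB0); rewrite {2}wE -[2 in RHS]ger0_norm// -!normrM.
    by congr (`|_|); lra.
  apply: sqrt_le_of_sqr; first by rewrite addr_ge0.
  move: E2; rewrite -(sqr_norm m) -(sqr_norm l) ml; move: `|m| => u; lra.
- rewrite /mxnorm kl normrN maxxx mulNr -expr2;
    move: (mxm p q e) (mxl p q e) => m l E1 E2.
  have ml : (dot p p + dot q q) * `|l| = `|dot p p - dot q q| * `|m|.
    transitivity `|(dot p p + dot q q) * l|.
      by rewrite normrM [in RHS]gtr0_norm// addr_gt0.
    rewrite wE -[2 in RHS]ger0_norm// -!normrM -E1 -normrN.
    by congr (`|_|); ring.
  apply: sqrt_le_of_sqr; first by rewrite addr_ge0.
  move: E2 ml; rewrite -(sqr_norm m) -(sqr_norm l).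
  have := normr_ge0 l; have := normr_ge0 m; move: `|m| `|l| => u v u0 v0 E2 ml.
  (* Edge ratio at least sqrt 2 means that the difference of the squared lengths is at least a third
     of their sum. Given u^2 - v^2 = 1, the goal 2 <= (u + v)^2 amounts to 2 (u - v) <= u + v, which
     is this inequality. *)
  have uv : u <= 3 * v.
    have S0 : 0 < dot p p + dot q q by rewrite addr_gt0.
    rewrite -(ler_pM2l S0) mulrCA ml mulrA ler_wpM2r//.
    by case: (ger0P (dot p p - dot q q)); case: AB; lra.
  have vv : u ^+ 2 <= (3 * v) ^+ 2 by rewrite ler_pXn2r ?nnegrE ?mulr_ge0.
  have uvm : u * u <= 3 * v * u by rewrite ler_wpM2r.
  rewrite exprMn in vv; lra.
Qed.

Lemma alpha1_surj (x : R) : 1 <= x <= Num.sqrt 2 ->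
  exists p q, det p q != 0 /\ alpha1 (box 0 p q) = x.
Proof.
move=> /andP[x1 x2].
have x0 : 0 < x by rewrite (lt_le_trans _ x1).
have xx2 : x ^+ 2 <= 2 by rewrite -[leRHS](@sqr_sqrtr _ 2)// ler_pXn2r ?nnegrE
  ?sqrtr_ge0// ltW.
have xx1 : 1 <= x ^+ 2 by rewrite -(expr1n _ 2) ler_pXn2r ?nnegrE ?(ltW x0).
(* Edges are scaled to lengths x and 1, and [w = dot p q] is chosen so that |p|^2 - |q|^2 = 2 (p.q).
   For x > 1 this puts the corner k = l at sqrt 2, while the corners m = 0 and k = -l both have
   value x. *)
pose w := (x ^+ 2 - 1) / 2; pose h := Num.sqrt (x ^+ 2 - w ^+ 2).
have h2 : 0 < x ^+ 2 - w ^+ 2 by rewrite /w; nra.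
have h0 : 0 < h by rewrite sqrtr_gt0.
pose p : plane R := (w, h); pose q : plane R := (1, 0).
have D0 : det p q != 0 by rewrite /det /= mulr0 mulr1 sub0r oppr_eq0 gt_eqF.
have AE : dot p p = x ^+ 2 by rewrite /dot /= -!expr2 sqr_sqrtr ?(ltW h2)//
  addrC subrK.
have BE : dot q q = 1 by rewrite /dot /=; ring.
have wE : dot p q = (x ^+ 2 - 1) / 2 by rewrite /dot /= /w; ring.
exists p, q; split => //; apply/eqP; rewrite eq_le; apply/andP; split.
  have [e e1 m0] := mxm_kernel p q.
  apply: le_trans (alpha1_le 0 D0 e1) _; rewrite /mxnorm m0 normr0 add0r.
  have [] := mxm0_sqr D0 e1 m0; rewrite AE BE mul1r => kE lE.
  have sq (r : R) : r ^+ 2 <= x ^+ 2 -> `|r| <= x.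
    by move=> rx; rewrite -(@ler_pXn2r _ 2)// ?nnegrE ?(ltW x0)// sqr_norm.
  rewrite ge_max !sq ?lE//.
  by rewrite -(@ler_pM2l _ (x ^+ 2)) ?exprn_gt0// kE -[leLHS]mulr1 ler_pM.
have [e [e1 -> cas]] := alpha1_attained 0 D0.
have N1 := mxnorm_ge1 D0 e1.
have := mx_det D0 e1; have := mx_sym e D0; rewrite AE BE wE.
case: cas => [m0|kl|kl].
- move=> _ _; rewrite /mxnorm m0 normr0 add0r; have [_] := mxm0_sqr D0 e1 m0.
  rewrite AE BE mul1r => lE; rewrite le_max -[x]gtr0_norm//; apply/orP; right.
  by rewrite -(@ler_pXn2r _ 2)// ?nnegrE// !sqr_norm lE.
- move: N1; rewrite /mxnorm kl maxxx -expr2;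
    move: (mxm p q e) (mxl p q e) => m l N1 E1 E2.
  have [xe|xe] := eqVneq (x ^+ 2 - 1) 0.
    have -> : x = 1 by nra.
    exact: N1.
  have ml : l = m by apply: (mulfI xe); lra.
  move: E2; rewrite ml -(sqr_norm m) => E2.
  rewrite -(@ler_pXn2r _ 2)// ?nnegrE ?addr_ge0 ?(ltW x0)//.
  move: E2; move: `|m| => u; lra.
- rewrite /mxnorm kl normrN maxxx mulNr -expr2;
    move: (mxm p q e) (mxl p q e) => m l E1.
  have ml : (x ^+ 2 + 1) * `|l| = (x ^+ 2 - 1) * `|m|.
    rewrite -[X in X * _ = _]ger0_norm; last by lra.
    rewrite -[X in _ = X * _]ger0_norm; last by lra.
    by rewrite -!normrM -normrN; congr (`|_|); lra.
  rewrite -(sqr_norm m) -(sqr_norm l) => E2.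
  rewrite -(@ler_pXn2r _ 2)// ?nnegrE ?addr_ge0 ?(ltW x0)//.
  move: ml E2; have := normr_ge0 l; have := normr_ge0 m;
    move: `|m| `|l| => u v u0 v0 ml E2.
  have E3 : u + v = x ^+ 2 * (u - v) by lra.
  have -> : (u + v) ^+ 2 = x ^+ 2 * (u ^+ 2 - v ^+ 2) by rewrite {1}expr2 {1}E3;
    ring.
  by rewrite E2 mulr1.
Qed.

End Values.

(** * Interior and diagonal angles *)

Section Angles.
Variable R : realType.
Implicit Types (x y z c d e o p q : plane R) (K : set (plane R)).

Definition edge_cos p q := cosine q p.
Definition diagonal_cos p q := cosine (- (p + q)) (p - q).

Lemma angle_edges c p q :
  angle (c - p + q) (c - p - q) (c + p - q) = acos (edge_cos p q).
Proof.
have -> : c - p + q = (c - p - q) + (2 : R) *: q by apply: plane_eq;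
  rewrite /= !scalerE; ring.
have -> : c + p - q = (c - p - q) + (2 : R) *: p by apply: plane_eq;
  rewrite /= !scalerE; ring.
by rewrite angleE cosineZ// cosineC cosineZ// cosineC.
Qed.

Lemma angle_diagonals c p q :
  angle (c - p - q) (midpoint (c - p - q) (c + p + q)) (c + p - q) =
  acos (diagonal_cos p q).
Proof.
have -> : midpoint (c - p - q) (c + p + q) = c.
  by apply: plane_eq; rewrite /= !scalerE; field.
by rewrite -[c - p - q]addrA -[c + p - q]addrA -opprD angleE.
Qed.

Lemma interior_anglesP K (t : R) : interior_angles K t <->
  exists c p q, [/\ det p q != 0, K = box c p q & t = acos (edge_cos p q)].
Proof.
split.
  move=> [A [B [C [D [/vertices_boxP[c [p [q [D0 KE AE BE [CE DE]]]]] ->]]]]].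
  by exists c, p, q; split => //; rewrite AE BE DE angle_edges.
move=> [c [p [q [D0 -> ->]]]]; do 4!eexists; split;
  first exact: vertices_box D0.
by rewrite angle_edges.
Qed.

Lemma diagonal_anglesP K (t : R) : diagonal_angles K t <->
  exists c p q, [/\ det p q != 0, K = box c p q & t = acos (diagonal_cos p q)].
Proof.
split.
  move=> [A [B [C [D [/vertices_boxP[c [p [q [D0 KE AE BE [CE DE]]]]] ->]]]]].
  by exists c, p, q; split => //; rewrite AE BE CE angle_diagonals.
move=> [c [p [q [D0 -> ->]]]]; do 4!eexists; split;
  first exact: vertices_box D0.
by rewrite angle_diagonals.
Qed.

Lemma cosine_sqr x y : cosine x y ^+ 2 = dot x y ^+ 2 / (dot x x * dot y y).
Proof. by rewrite /cosine expr_div_n exprMn !enorm_sqr. Qed.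

Lemma enormN x : enorm (- x) = enorm x.
Proof. by rewrite -scaleN1r enormZ normrN1 mul1r. Qed.

Lemma edge_cos_oppl p q : edge_cos (- p) q = - edge_cos p q.
Proof.
rewrite /edge_cos /cosine enormN -mulNr.
by congr (_ / _); rewrite /dot /=; ring.
Qed.

Lemma diagonal_cos_swap p q : diagonal_cos q p = - diagonal_cos p q.
Proof.
rewrite /diagonal_cos /cosine -(opprB p q) (enormN (p - q)) (addrC q p) -mulNr.
by congr (_ / _); rewrite /dot /=; ring.
Qed.

(* Both squared cosines are rational in |p|^2, |q|^2 and p.q, and clearing
   denominators in their equality leaves a multiple of det(p,q)^2. *)
Lemma cos_sqr_eq p q : det p q != 0 ->
  diagonal_cos p q ^+ 2 = edge_cos p q ^+ 2 <->
  `|dot p p - dot q q| = 2 * `|dot p q|.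
Proof.
move=> D0; have [p0 q0] := det_neq0 D0.
have A0 := dot_gt0 p0; have B0 := dot_gt0 q0.
have D1 : 0 < det p q ^+ 2 by rewrite lt0r sqrf_eq0 D0 sqr_ge0.
have DE : det p q ^+ 2 = dot p p * dot q q - dot p q ^+ 2 by rewrite /det /dot;
  ring.
have Dp : dot (- (p + q)) (- (p + q)) = dot p p + dot q q + 2 * dot p q by
  rewrite /dot /=; ring.
have Dm : dot (p - q) (p - q) = dot p p + dot q q - 2 * dot p q by rewrite /dot
  /=; ring.
have Dpm : dot (- (p + q)) (p - q) = dot q q - dot p p by rewrite /dot /=; ring.
have Dp0 : 0 < dot p p + dot q q + 2 * dot p q.
  rewrite -Dp; apply: dot_gt0; apply: contra D0;
    rewrite oppr_eq0 addr_eq0 => /eqP ->.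
  by apply/eqP; rewrite /det /=; ring.
have Dm0 : 0 < dot p p + dot q q - 2 * dot p q.
  rewrite -Dm; apply: dot_gt0; apply: contra D0; rewrite subr_eq0 => /eqP ->.
  by apply/eqP; rewrite /det /=; ring.
rewrite /edge_cos /diagonal_cos !cosine_sqr Dp Dm Dpm (dotC q p).
move: Dp0 Dm0 D1 A0 B0; rewrite DE.
move: (dot p p) (dot q q) (dot p q) => a b w Dp0 Dm0 D1 A0 B0.
have key : ((a + b + 2 * w) * (a + b - 2 * w) * (b * a)) *
   ((b - a) ^+ 2 / ((a + b + 2 * w) * (a + b - 2 * w)) - w ^+ 2 / (b * a)) =
   (a * b - w ^+ 2) * ((a - b) ^+ 2 - (2 * w) ^+ 2).
  by field; rewrite !gt_eqF.
split => H.
  move: key; rewrite H subrr mulr0 => /esym/eqP;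
    rewrite mulf_eq0 gt_eqF//= subr_eq0.
  by rewrite eqf_sqr => /orP[]/eqP ->; rewrite ?normrN normrM (@ger0_norm _ 2).
apply/eqP; rewrite -subr_eq0.
have P0 : (a + b + 2 * w) * (a + b - 2 * w) * (b * a) != 0 by rewrite !mulf_neq0
  ?gt_eqF.
rewrite -(mulrI_eq0 _ (mulfI P0)) key.
rewrite -[(a - b) ^+ 2]sqr_norm -[(2 * w) ^+ 2]sqr_norm normrM (@ger0_norm _
  2)// H.
by rewrite subrr mulr0.
Qed.

Lemma acos_inj_cosine x y z t :
  acos (cosine x y) = acos (cosine z t) -> cosine x y = cosine z t.
Proof. by move=> /(congr1 cos); rewrite !acosK ?in_itv/= ?cosine_itv. Qed.

(** Adjacent interior angles are supplementary, so the square is what does not depend on the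
    listing. *)
Lemma edge_cos_sqr_box c p q c' p' q' : det p q != 0 -> det p' q' != 0 ->
  box c p q = box c' p' q' -> edge_cos p' q' ^+ 2 = edge_cos p q ^+ 2.
Proof.
move=> D0 D0' /(box_inj D0 D0') [s [t [s1 t1 pq]]].
rewrite /edge_cos !cosine_sqr.
have dZ (a b : R) x y : dot (a *: x) (b *: y) = a * b * dot x y.
  by rewrite /dot /= !scalerE; ring.
case: pq => -[-> ->]; rewrite !dZ -!expr2 s1 t1 !mul1r !exprMn s1 t1 !mul1r//.
by rewrite (dotC p q) (mulrC (dot p p)).
Qed.

Lemma sqrt2_ratio (a b : R) : 0 < a -> 0 < b ->
  Num.sqrt 2 <= Num.max a b / Num.min a b <->
  2 * a ^+ 2 <= b ^+ 2 \/ 2 * b ^+ 2 <= a ^+ 2.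
Proof.
have s2 : Num.sqrt 2 ^+ 2 = 2 :> R by rewrite sqr_sqrtr.
have key (u v : R) : 0 < u -> 0 < v ->
  (Num.sqrt 2 <= v / u) = (2 * u ^+ 2 <= v ^+ 2).
  move=> u0 v0; rewrite ler_pdivlMr// -(@ler_pXn2r _ 2)// ?nnegrE ?mulr_ge0
    ?sqrtr_ge0 ?(ltW u0) ?(ltW v0)//.
  by rewrite exprMn s2.
move=> a0 b0; have [ab|ba] := leP a b; rewrite key//; split; try tauto.
- case=> // h; have : a ^+ 2 <= b ^+ 2 by rewrite ler_pXn2r ?nnegrE ?(ltW a0)
    ?(ltW b0).
  have : 0 < b ^+ 2 by rewrite exprn_gt0.
  by lra.
- case=> // h; have : b ^+ 2 <= a ^+ 2 by rewrite ler_pXn2r ?nnegrE ?(ltW a0)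
    ?(ltW b0) ?(ltW ba).
  have : 0 < a ^+ 2 by rewrite exprn_gt0.
  by lra.
Qed.

End Angles.

Theorem theorem1p4 (R : realType) :
  (forall K : set (plane R), parallelogram K ->
    (exists U : set (plane R),
      is_line U /\ containment_radius K (reflection U @` K) = alpha1 K) /\
    (forall U : set (plane R),
      is_line U -> containment_radius K (reflection U @` K) = alpha1 K ->
      exists L : set (plane R), parallel U L /\
        [\/ edge_bisector K L,
            diagonal_bisector K L |
            exists E : set (plane R),
              john_ellipse K E /\ principal_axis E L])) /\
  [set alpha1 K | K in @parallelogram R] =
    [set x : R | 1 <= x <= Num.sqrt 2] /\
  (forall K : set (plane R), parallelogram K ->
    (alpha1 K = 1 <-> rectangle K \/ rhombus K) /\
    (alpha1 K = Num.sqrt 2 <->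
      diagonal_angles K = interior_angles K /\
      exists A B C D : plane R, vertices K A B C D /\
        Num.sqrt 2 <= Num.max (enorm (B - A)) (enorm (D - A)) /
                      Num.min (enorm (B - A)) (enorm (D - A)))).
Proof.
split=> [K /parallelogram_boxP[c [p [q [D0 ->]]]]|].
  have [e [e1 eE emin]] := alpha1_box c D0.
  split.
    have [d d0 de] := double_dir_surj e1.
    by exists (line 0 d); rewrite containment_box// de; split => //;
      exists 0, d.
  move=> _ [r [d [d0 ->]]]; rewrite containment_box// => dE.
  have [|m0|kl|kl] := mxnorm_minimizer D0 (dot_double_dir d0).
  - by move=> e' e1'; rewrite dE eE emin.
  - have [y Ly] := edge_bisector_box c D0 d0 m0.
    by exists (line y d); split; [exact: line_parallel|exact: Or31].
  - exists (line c d); split; first exact: line_parallel.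
    by apply: Or33; exists (ellipsoid c p q); exact: john_axis_box.
  - have [y Ly] := diagonal_bisector_box c D0 d0 kl.
    by exists (line y d); split; [exact: line_parallel|exact: Or32].
split.
  apply/seteqP; split => x.
    move=> [K /parallelogram_boxP[c [p [q [D0 ->]]]] <-] /=.
    by rewrite alpha1_ge1// alpha1_le_sqrt2.
  move=> /alpha1_surj[p [q [D0 <-]]].
  by exists (box 0 p q) => //; apply/parallelogram_boxP; exists 0, p, q.
have hB (c p q : plane R) : c + p - q - (c - p - q) = (2 : R) *: p.
  by apply: plane_eq; rewrite /= !scalerE; ring.
have hD (c p q : plane R) : c - p + q - (c - p - q) = (2 : R) *: q.
  by apply: plane_eq; rewrite /= !scalerE; ring.
have dot2 (x y : plane R) : dot ((2 : R) *: x) ((2 : R) *: y) = 4 * dot x y.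
  by rewrite /dot /= !scalerE; ring.
have enorm2 (x : plane R) : enorm ((2 : R) *: x) ^+ 2 = 4 * dot x x.
  by rewrite enorm_sqr dot2.
move=> K /parallelogram_boxP[c [p [q [D0 KE]]]].
have eqV := vertices_box c D0.
split.
  split.
    rewrite KE => /(alpha1_eq1 c D0)[w0|AB]; [left|right]; do 4!eexists.
      by split; first exact: eqV; rewrite hB hD dot2 w0 mulr0.
    by split; first exact: eqV; rewrite hB hD /enorm !dot2 AB.
  case=> [[A [B [C [D [/vertices_boxP[c' [p' [q' [D0' -> -> -> [_ ->]]]]]]]]]]|
          [A [B [C [D [/vertices_boxP[c' [p' [q' [D0' -> -> -> [_ ->]]]]]]]]]]].
    rewrite hB hD dot2 => /eqP; rewrite mulf_eq0 pnatr_eq0 /= => /eqP w0.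
    by apply/alpha1_eq1 => //; left.
  rewrite hB hD => /(congr1 (fun r => r ^+ 2)); rewrite !enorm2 => AB.
  by apply/alpha1_eq1 => //; right; lra.
have ratioP p' q' : det p' q' != 0 ->
    Num.sqrt 2 <= Num.max (enorm ((2 : R) *: p')) (enorm ((2 : R) *: q')) /
                  Num.min (enorm ((2 : R) *: p')) (enorm ((2 : R) *: q')) <->
    (2 * dot p' p' <= dot q' q' \/ 2 * dot q' q' <= dot p' p').
  move=> D0'; have [p0 q0] := det_neq0 D0'.
  have n2 (x : plane R) : x != 0 -> 0 < enorm ((2 : R) *: x).
    by move=> x0; rewrite enormZ mulr_gt0 ?enorm_gt0// normr_gt0.
  rewrite sqrt2_ratio ?n2// !enorm2.
  by split=> -[]; [left|right|left|right]; lra.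
split.
  move=> aE.
  have cosE c' p' q' : det p' q' != 0 -> K = box c' p' q' ->
      diagonal_cos p' q' ^+ 2 = edge_cos p' q' ^+ 2.
    move=> D0' KE'; apply/cos_sqr_eq => //.
    by have [] := (alpha1_eq_sqrt2 c' D0').1 _; rewrite -?KE'.
  split; last first.
    have [_ AB] := (alpha1_eq_sqrt2 c D0).1 (etrans (congr1 _ (esym KE)) aE).
    exists (c - p - q), (c + p - q), (c + p + q), (c - p + q).
    split; first by rewrite KE.
    by rewrite hB hD; apply/(ratioP _ _ D0).
  apply/seteqP; split => t.
    move=> /diagonal_anglesP[c' [p' [q' [D0' KE' ->]]]]; apply/interior_anglesP.
    (* Equal squares leave a sign, absorbed by another listing of the same set: [- p'] gives the
       interior angle at an adjacent vertex, and in the reverse inclusion exchanging [p'] and [q']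
       gives the supplementary diagonal angle. *)
    have /eqP := cosE _ _ _ D0' KE'; rewrite eqf_sqr => /orP[]/eqP ->.
      by exists c', p', q'.
    exists c', (- p'), q'; rewrite box_opp edge_cos_oppl; split => //.
    by rewrite (_ : det _ _ = - det p' q') ?oppr_eq0// /det /=; ring.
  move=> /interior_anglesP[c' [p' [q' [D0' KE' ->]]]]; apply/diagonal_anglesP.
  have /eqP := cosE _ _ _ D0' KE'; rewrite eq_sym eqf_sqr => /orP[]/eqP ->.
    by exists c', p', q'.
  exists c', q', p'; rewrite box_swap (diagonal_cos_swap p' q'); split => //.
  by rewrite det_swap oppr_eq0.
move=> [angE [A [B [C [D [/vertices_boxP[c' [p' [q' [D0' KE' -> ->
  [_ ->]]]]]]]]]]].
rewrite hB hD => /(ratioP _ _ D0') AB.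
rewrite KE'; apply/alpha1_eq_sqrt2 => //; split => //.
apply/cos_sqr_eq => //.
(* One diagonal angle suffices: it is an interior angle for some listing [p2], [q2], whose squared
   cosine agrees with that of [p'], [q']. *)
have : diagonal_angles K (acos (diagonal_cos p' q')).
  by apply/diagonal_anglesP; exists c', p', q'.
rewrite angE => /interior_anglesP[c2 [p2 [q2 [D2 KE2 /acos_inj_cosine]]]].
rewrite -/(diagonal_cos p' q') -/(edge_cos p2 q2) => ->.
by apply: (@edge_cos_sqr_box _ c' _ _ c2); rewrite -?KE'.
Qed.
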